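(* Let $p$ be a prime number, $K$ a finite extension of $\mathbb{Q}_p$ with ring of integers $\mathcal{O}_K$ and ramification index $e$. Let $n,g\ge 1$ be integers, let $N\in\frac1e\mathbb{Z}$ with $N>0$, let $G\in\mathcal{O}_K[[t]]^g$ and let $\mathrm f=(f_{ij})\in M_g(\mathcal{O}_K[[t]])$. Put $H_{\mathrm f}(x_1,\dots,x_g)=\big(f_{ij}(x_j)\big)_{1\le i,j\le g}$ for $(x_1,\dots,x_g)\in (tK[[t]])^g$. Assume that $H_{\mathrm f}(0)$ is invertible in $M_g(\mathcal{O}_K)$ and that the components of the solution $X\in(tK[[t]])^g$ of the differential equation $H_{\mathrm f}(X)\cdot X'=G$ have coefficients in $\mathcal{O}_K$. Suppose that the procedure $\mathtt{DiffSolve}(G,\mathrm f,n,g)$ is run with fixed point arithmetic at precision $O(p^M)$, where $$M=\begin{cases}\max(N,3)+\lfloor\log_p(n)\rfloor & \text{if } p=2,\\ \max(N,2)+\lfloor \log_p(n)\rfloor & \text{if } p=3,\\ N+\lfloor\log_p(n)\rfloor & \text{otherwise.}\end{cases}$$ Then all the computations are done in $\mathcal{O}_K$ and the result (the approximation of $X$ modulo $t^{n+1}$) is correct at precision $O(p^N)$.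
   Context: For $Y\in K[[t]]^g$, $\int Y\,dt$ denotes the unique $I\in K[[t]]^g$ with $I'=Y$ and $I(0)=0$. When $H_{\mathrm f}(0)$ is invertible, the equation $H_{\mathrm f}(X)\cdot X'=G$ has a unique solution $X\in (tK[[t]])^g$. Procedure $\mathtt{DiffSolve}(G,\mathrm f,n,g)$. Input: $G,\mathrm f \bmod t^n$ with $H_{\mathrm f}(0)$ invertible. Output: the solution $X \bmod t^{n+1}$ together with $H_{\mathrm f}(X)^{-1}\bmod t^{\lceil n/2\rceil}$. 1. If $n=0$, return $0 \bmod t$ and $H_{\mathrm f}(0)^{-1}\bmod t$. 2. Put $m:=\lceil \frac{n-1}{2}\rceil$ and recursively compute $(X_m,H_m):=\mathtt{DiffSolve}(G,\mathrm f,m,g)$. 3. Put $H_n:=2H_m-H_m\cdot H_{\mathrm f}(X_m)\cdot H_m \bmod t^{m+1}$. 4. Return $X_m+H_n\int\big(G-H_{\mathrm f}(X_m)\cdot X_m'\big)\,dt \bmod t^{n+1}$, together with $H_n$. Fixed point arithmetic at precision $O(p^M)$: let $\pi$ be a uniformizer of $K$ and $\upsilon_p$ the extension to $K$ (and to quotients of $\mathcal{O}_K$) of the $p$-adic valuation. An element is represented by an interval $a+O(p^M)$ with $a\in\mathcal{O}_K/\pi^{eM}\mathcal{O}_K$. Additions, subtractions and multiplications are those of $\mathcal{O}_K/\pi^{eM}\mathcal{O}_K$. The division of $x+O(p^M)$ by $y+O(p^M)$ raises an error if $\upsilon_p(y)>\upsilon_p(x)$, returns $0+O(p^M)$ if $x=0$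 in $\mathcal{O}_K/\pi^{eM}\mathcal{O}_K$, and otherwise returns any $z+O(p^M)$ with $x=yz$ in $\mathcal{O}_K/\pi^{eM}\mathcal{O}_K$. Matrix operations are defined entrywise from these; inversion of matrices uses Gaussian elimination. ''All the computations are done in $\mathcal{O}_K$'' means that no division raises an error; ''correct at precision $O(p^N)$'' means that the result is congruent to $X$ modulo $(\pi^{eN},t^{n+1})$. *)

(* Defs.v *)
From HB Require Import structures.
From mathcomp Require Import all_boot all_order all_algebra all_field.
From mathcomp Require Import boolp constructive_ereal.

Set Implicit Arguments.
Unset Strict Implicit.
Unset Printing Implicit Defensive.

Import Order.TTheory GRing.Theory Num.Theory.
Local Open Scope ring_scope.
Local Open Scope quotient_scope.

Record valuation (K : fieldType) := Valuation {
  val_fun :> K -> \bar rat;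
  val_eq_pinfty : forall x, val_fun x = +oo%E <-> x = 0;
  val_neq_ninfty : forall x, val_fun x <> -oo%E;
  valM : forall x y, val_fun (x * y)%R = (val_fun x + val_fun y)%E;
  valD : forall x y, (mine (val_fun x) (val_fun y) <= val_fun (x + y)%R)%E
}.

Definition padic_val (p : nat) (q : rat) : rat :=
  (logn p `|numq q|)%:R - (logn p `|denq q|)%:R.

(* [Qp], with the valuation [v], is a completion of the field of rational
   numbers for the p-adic valuation, i.e., a copy of the field of p-adic
   numbers (unique up to a unique valued field isomorphism). *)
Record is_padic_field (p : nat) (Qp : fieldType) (v : valuation Qp) : Prop :=
  IsPadicField {
  padic_ext : forall q : rat, q != 0 -> v (ratr q) = (padic_val p q)%:E;
  padic_dense : forall (x : Qp) (B : rat),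
    exists q : rat, (B%:E <= v (x - ratr q)%R)%E;
  padic_complete : forall u : nat -> Qp,
    (forall B : rat, exists n0 : nat, forall m n : nat,
       (n0 <= m)%N -> (n0 <= n)%N -> (B%:E <= v (u m - u n)%R)%E) ->
    exists l : Qp, forall B : rat, exists n0 : nat, forall n : nat,
       (n0 <= n)%N -> (B%:E <= v (u n - l)%R)%E
}.

Section RingOfIntegers.
Variables (K : fieldType) (v : valuation K).

Lemma val_fin (x : K) : x != 0 -> {q : rat | v x = q%:E}.
Proof.
move=> x0; case Ev: (v x) => [q||]; first by exists q.
- by move/val_eq_pinfty: Ev x0 => ->; rewrite eqxx.
- by case: (val_neq_ninfty Ev).
Qed.

Lemma val1 : v 1 = 0%E.
Proof.
have [q Eq] := val_fin (oner_neq0 K).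
have := valM v 1 1; rewrite mulr1 Eq -EFinD => -[] /eqP.
by rewrite -subr_eq0 opprD addrA subrr sub0r oppr_eq0 => /eqP ->.
Qed.

Lemma valN (x : K) : v (- x) = v x.
Proof.
have N1 : (-1 : K) != 0 by rewrite oppr_eq0 oner_neq0.
have [q Eq] := val_fin N1.
have := valM v (-1) (-1); rewrite mulrNN mulr1 val1 Eq -EFinD => -[] /eqP.
rewrite eq_sym -mulr2n mulrn_eq0 /= => /eqP q0.
by rewrite -mulN1r valM Eq q0 add0e.
Qed.

Definition integral_pred : pred K := fun x => (0 <= v x)%E.

Fact integral_pred_subring : subring_closed integral_pred.
Proof.
split; rewrite /integral_pred /in_mem /=.
- by rewrite val1.
- move=> x y hx hy; rewrite /in_mem /=; apply: (le_trans _ (valD v x (- y))).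
  by rewrite valN le_min; apply/andP; split.
- by move=> x y hx hy; rewrite /in_mem /= valM adde_ge0.
Qed.
HB.instance Definition _ :=
  GRing.isSubringClosed.Build K integral_pred integral_pred_subring.

Record ringOfIntegers := RingOfIntegers {
  int_val :> K;
  _ : int_val \in integral_pred
}.
HB.instance Definition _ := [isSub for int_val].
HB.instance Definition _ := [Choice of ringOfIntegers by <:].
HB.instance Definition _ :=
  [SubChoice_isSubComNzRing of ringOfIntegers by <:].

(* A generator of the maximal ideal of the ring of integers. *)
Record uniformizer := Uniformizer {
  unif_val :> ringOfIntegers;
  uniformizerP : forall x : ringOfIntegers,
    (0 < v x)%E <-> exists y : ringOfIntegers, x = unif_val * y
}.

Definition is_ramification_index (p : nat) (pi : uniformizer) (e : nat) :=
  exists u : ringOfIntegers, v u = 0%E /\ p%:R = u * (pi : ringOfIntegers) ^+ e.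

End RingOfIntegers.

Section FixedPointRing.
Variables (K : fieldType) (v : valuation K) (pi : uniformizer v) (k : nat).
Local Notation OK := (ringOfIntegers v).

(* The quotient of the ring of integers by pi^k is a nonzero ring only when
   0 < k; as with 'Z_n, the exponent is therefore replaced by [k.-1.+1], which
   is k whenever 0 < k. *)
Definition unif_ideal : pred OK :=
  fun x => `[< exists y : OK, x = (pi : OK) ^+ k.-1.+1 * y >].

Lemma val_unif_gt0 : (0 < v (pi : OK))%E.
Proof. by apply/(uniformizerP pi); exists 1; rewrite mulr1. Qed.

Fact unif_ideal_closed : idealr_closed unif_ideal.
Proof.
split; rewrite /unif_ideal /in_mem /=.
- by apply/asboolP; exists 0; rewrite mulr0.
- apply/asboolP => -[y]; rewrite exprS -mulrA => E.
  have : (0 < v (1%R : OK))%E by apply/(uniformizerP pi); eexists; exact: E.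
  by rewrite val1 ltxx.
- move=> a x y /asboolP [x' ->] /asboolP [y' ->]; apply/asboolP.
  by exists (a * x' + y'); rewrite mulrDr mulrCA.
Qed.
HB.instance Definition _ := isIdealr.Build OK unif_ideal unif_ideal_closed.

Definition fixp := {ideal_quot (unif_ideal : idealr OK)}.
HB.instance Definition _ := GRing.ComNzRing.on fixp.
HB.instance Definition _ := Quotient.on fixp.

(* All the lifts of a nonzero class have the same valuation. *)
Definition fixp_val (a : fixp) : \bar rat :=
  if a == 0 then +oo%E else v (repr a : OK).

End FixedPointRing.

(* A nondeterministic computation is the set of its possible outcomes, [None]
   standing for an error. *)
Definition outcomes (T : Type) := option T -> Prop.

Definition ret {T} (x : T) : outcomes T := fun o => o = Some x.

Definition choose {T} (P : T -> Prop) : outcomes T :=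
  fun o => exists2 x, P x & o = Some x.

Definition bind {T U} (m : outcomes T) (k : T -> outcomes U) : outcomes U :=
  fun o => (m None /\ o = None) \/ exists2 x, m (Some x) & k x o.

Notation "'let!' x := m 'in' k" := (bind m (fun x => k))
  (at level 200, x strict pattern, m at level 200, k at level 200).

Section FixedPointAlgorithms.
(* In the application, [A] is a ring [fixp pi k] and [av] is [fixp_val]. *)
Variables (A : comNzRingType) (av : A -> \bar rat).

(* Since the valuation of 0 is +oo, dividing 0 never fails and dividing a
   nonzero element by 0 always does. *)
Definition fdiv (x y : A) : outcomes A := fun o =>
  match o with
  | None => (av x < av y)%E
  | Some z => if x == 0 then z = 0 else (av y <= av x)%E /\ x = y * z
  end.

Definition fdivs {I : Type} (x y : I -> A) : outcomes (I -> A) := fun o =>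
  match o with
  | None => exists i, fdiv (x i) (y i) None
  | Some z => forall i, fdiv (x i) (y i) (Some (z i))
  end.

(* Treatment of column [j] of [(B | C)] in Gauss-Jordan elimination: the pivot
   may be any entry of least valuation on or below the diagonal (with a pivot
   of larger valuation, the divisions by the pivot could fail even when the
   matrix is invertible). *)
Definition gauss_column g (j : 'I_g) (S : 'M[A]_(g, g + g)) :
    outcomes 'M[A]_(g, g + g) :=
  let c := lshift g j in
  let! r := choose (fun r : 'I_g => (j <= r)%N /\
         forall i : 'I_g, (j <= i)%N -> (av (S r c) <= av (S i c))%E) in
  let T := xrow j r S in
  let! u := fdivs (T j) (fun=> T j c) in
  ret (\matrix_(i, l) if i == j then u l else T i l - T i c * u l).

Fixpoint gauss g (js : seq 'I_g) (S : 'M[A]_(g, g + g)) :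
    outcomes 'M[A]_(g, g + g) :=
  if js is j :: js' then let! T := gauss_column j S in gauss js' T else ret S.

Definition finvmx g (B : 'M[A]_g) : outcomes 'M[A]_g :=
  let! T := gauss (enum 'I_g) (row_mx B 1%:M) in ret (rsubmx T).

(* The primitive, modulo t^(n+1), of a vector of series known modulo t^n. *)
Definition fintegral g (n : nat) (Y : 'cV[{poly A}]_g) :
    outcomes 'cV[{poly A}]_g :=
  let! q := fdivs (fun ai : 'I_g * 'I_n => (Y ai.1 0)`_(ai.2))
             (fun ai => ai.2.+1%:R) in
  ret (\col_a \sum_(i < n) q (a, i) *: 'X^(i.+1)).

(* The argument has no constant term, so that truncating [f] modulo t^n only
   affects the coefficients of degree at least n. *)
Definition Hmx g (f : 'M[{poly A}]_g) (x : 'cV[{poly A}]_g) : 'M[{poly A}]_g :=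
  \matrix_(i, j) (f i j \Po x j 0).

(* [uphalf n.-1] is the ceiling of (n - 1) / 2. Products are computed in full
   and truncated at the end; [fintegral n] only reads the first n coefficients
   of its argument. *)
Inductive DiffSolve g (G : 'cV[{poly A}]_g) (f : 'M[{poly A}]_g) :
    nat -> outcomes ('cV[{poly A}]_g * 'M[{poly A}]_g) :=
| DiffSolve0 o :
    (let! B := finvmx (\matrix_(i, j) (f i j)`_0) in ret (0, map_mx polyC B)) o ->
    DiffSolve G f 0 o
| DiffSolveS n o : (0 < n)%N ->
    let m := uphalf n.-1 in
    (let! (Xm, Hm) := DiffSolve G f m in
     let Hn := map_mx (take_poly m.+1)
                 (Hm *+ 2 - Hm *m Hmx f Xm *m Hm) in
     let! E := fintegral n (G - Hmx f Xm *m map_mx deriv Xm) in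
     ret (map_mx (take_poly n.+1) (Xm + Hn *m E), Hn)) o ->
    DiffSolve G f n o.

End FixedPointAlgorithms.

(* A power series over [R] is given by its sequence of coefficients. *)
Section PowerSeries.
Variable R : comNzRingType.

Definition fps_mul (a b : nat -> R) : nat -> R :=
  fun k => \sum_(i < k.+1) a i * b (k - i)%N.

Definition fps_exp (a : nat -> R) (d : nat) : nat -> R :=
  iter d (fps_mul a) (fun k => (k == 0%N)%:R).

(* Only meaningful when [x 0 = 0], which bounds the sum giving the k-th
   coefficient. *)
Definition fps_comp (f x : nat -> R) : nat -> R :=
  fun k => \sum_(d < k.+1) f d * fps_exp x d k.

Definition fps_deriv (a : nat -> R) : nat -> R := fun k => a k.+1 *+ k.+1.

Definition fps_H g (f : 'I_g -> 'I_g -> nat -> R) (x : 'I_g -> nat -> R) :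
    'I_g -> 'I_g -> nat -> R :=
  fun i j => fps_comp (f i j) (x j).

Definition is_solution g (f : 'I_g -> 'I_g -> nat -> R)
    (G X : 'I_g -> nat -> R) : Prop :=
  (forall j, X j 0%N = 0) /\
  forall i k, \sum_j fps_mul (fps_H f X i j) (fps_deriv (X j)) k = G i k.

End PowerSeries.

Section Reduction.
Variables (K : fieldType) (v : valuation K) (pi : uniformizer v) (k n g : nat).
Local Notation OK := (ringOfIntegers v).

Definition red_poly (a : nat -> OK) : {poly fixp pi k} :=
  \poly_(d < n) \pi_(fixp pi k) (a d).

Definition red_col (G : 'I_g -> nat -> OK) : 'cV[{poly fixp pi k}]_g :=
  \col_i red_poly (G i).

Definition red_mx (f : 'I_g -> 'I_g -> nat -> OK) : 'M[{poly fixp pi k}]_g :=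
  \matrix_(i, j) red_poly (f i j).

End Reduction.

Definition working_precision (p n : nat) (N : rat) : rat :=
  (if p == 2%N then Num.max N 3 else if p == 3%N then Num.max N 2 else N)
  + (trunc_log p n)%:R.

(* Main.v *)
Require Import Defs.
From HB Require Import structures.
From mathcomp Require Import all_boot all_order all_algebra all_field.
From mathcomp Require Import boolp constructive_ereal.
From mathcomp Require Import zify ring lra.

Set Implicit Arguments.
Unset Strict Implicit.
Unset Printing Implicit Defensive.

Import Order.TTheory GRing.Theory Num.Theory.
Local Open Scope ring_scope.
Local Open Scope quotient_scope.

(** Write A for the ring of integers modulo pi^k, of precision M = k / e, and
    S(x) for H_f(x) x'.  The proof separates an exact computation over A from a
    perturbation argument over K.

    Over A, the algorithm makes no error that it does not absorb.  A division
    of x by y returns some z with x = y z, so the vector E produced by the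
    integration step satisfies E' = G - S(x_m) exactly in A, modulo t^n,
    whichever quotients were returned.  Because the variables are separated,
    the first order variation of S at x is h |-> (H_f(x) h)'; hence Newton's
    step turns a solution of S(x) = G modulo t^m into a solution modulo t^n
    over any commutative ring, in particular over A ([newton_solution]).
    Similarly the inverse of H_f(x) is carried along exactly, starting from a
    Gauss-Jordan elimination which cannot fail on an invertible matrix over a
    local ring, where a pivot of least valuation is a unit ([sound_finvmx]).

    It remains to control what S(x) = G modulo (t^m, pi^k) says about x.  Let F
    be the matrix of the primitives of the entries of f, so that S(x) is the
    derivative of the vector of the sums over j of F_ij(x_j).  By Taylor's
    formula, for h = X - x,
      F(X) - F(x) = f(x) h + sum over k >= 2 of f^[k-1](x) h^k / k,
    where f^[k-1], the derivative of order k-1 divided by (k-1)!, is integral.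
    The left-hand side has a d-th coefficient of valuation at least M - v(d),
    and f(0) is invertible; so an induction on d gives
      v(h_d) >= M - floor(log_p d)
    ([precision_loss]), as soon as the terms h^k / k are harmless
    ([vge_coef_exp_div]).  They are, since in a product of k coefficients of h
    whose degrees add up to at most d < p^(l+1), at most p - 1 of the factors
    have a degree at least p^l, and all the others are one digit more precise,
    which compensates the division by k when p divides k.

    For m = n this is the correctness of the result, M - floor(log_p n) being at
    least N.  For m = floor(n / 2) it shows that no division fails in the Newton
    step from m to n: the residual G - S(x_m) is congruent to S(X) - S(x_m),
    which differs from the derivative of an integral series only by the
    derivatives of the terms h^k / k, and these terms are integral
    ([defect_integrable]). *)

(** * Congruences modulo a power of the variable, and Newton's step *)

Section TruncatedCongruence.
Variable R : comNzRingType.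

Definition eqmodX n a b (A B : 'M[{poly R}]_(a, b)) :=
  exists C, A = B + 'X^n *: C.

Lemma eqmodXP n a b (A B : 'M[{poly R}]_(a, b)) :
  eqmodX n A B <-> forall i j d, (d < n)%N -> (A i j)`_d = (B i j)`_d.
Proof.
split=> [[C ->] i j d ltdn|eqAB].
  by rewrite !mxE coefD coefXnM ltdn addr0.
exists (\matrix_(i, j) drop_poly n (A i j - B i j)).
apply/matrixP=> i j; rewrite !mxE mulrC -[LHS](subrK (B i j)) addrC.
congr (_ + _); rewrite -[LHS](poly_take_drop n) -[RHS]add0r.
congr (_ + _); apply/polyP=> d; rewrite coef_take_poly coef0.
by case: ltnP => // ltdn; rewrite coefB eqAB ?subrr.
Qed.

Lemma eqmodX_refl n a b (A : 'M[{poly R}]_(a, b)) : eqmodX n A A.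
Proof. by exists 0; rewrite scaler0 addr0. Qed.

Lemma eqmodX_trans n a b (B A C : 'M[{poly R}]_(a, b)) :
  eqmodX n A B -> eqmodX n B C -> eqmodX n A C.
Proof. by case=> D -> [E ->]; exists (E + D); rewrite scalerDr addrA. Qed.

Lemma eqmodX_leq n k a b (A B : 'M[{poly R}]_(a, b)) :
  (k <= n)%N -> eqmodX n A B -> eqmodX k A B.
Proof.
by move=> lekn [C ->]; exists ('X^(n - k) *: C); rewrite scalerA -exprD subnKC.
Qed.

Lemma eqmodXD n a b (A B A' B' : 'M[{poly R}]_(a, b)) :
  eqmodX n A B -> eqmodX n A' B' -> eqmodX n (A + A') (B + B').
Proof. by case=> C -> [C' ->]; exists (C + C'); rewrite scalerDr addrACA. Qed.

Lemma eqmodXN n a b (A B : 'M[{poly R}]_(a, b)) :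
  eqmodX n A B -> eqmodX n (- A) (- B).
Proof. by case=> C ->; exists (- C); rewrite scalerN opprD. Qed.

Lemma eqmodXM n a b c (A B : 'M[{poly R}]_(a, b)) (A' B' : 'M_(b, c)) :
  eqmodX n A B -> eqmodX n A' B' -> eqmodX n (A *m A') (B *m B').
Proof.
case=> C -> [C' ->]; exists (C *m (B' + 'X^n *: C') + B *m C').
by rewrite scalerDr mulmxDl mulmxDr -!scalemxAl -scalemxAr addrAC addrA.
Qed.

Lemma eqmodXM0 m n a b c (A : 'M[{poly R}]_(a, b)) (B : 'M_(b, c)) :
  eqmodX m A 0 -> eqmodX n B 0 -> eqmodX (m + n) (A *m B) 0.
Proof.
case=> C -> [D ->]; exists (C *m D).
by rewrite !add0r -scalemxAl -scalemxAr scalerA exprD.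
Qed.

Lemma eqmodX_deriv n a b (A B : 'M[{poly R}]_(a, b)) :
  eqmodX n.+1 A B -> eqmodX n (map_mx (@deriv R) A) (map_mx (@deriv R) B).
Proof.
move=> /eqmodXP eqAB; apply/eqmodXP=> i j d ltdn.
by rewrite !mxE !coef_deriv eqAB.
Qed.

Lemma eqmodX_take n a b (A : 'M[{poly R}]_(a, b)) :
  eqmodX n (map_mx (take_poly n) A) A.
Proof. by apply/eqmodXP=> i j d ltdn; rewrite mxE coef_take_poly ltdn. Qed.

(** Stated with divided derivatives, hence valid in any characteristic. *)
Lemma comp_poly_taylor (f x h : {poly R}) n : (size f <= n)%N ->
  f \Po (x + h) = \sum_(k < n) (f^`N(k) \Po x) * h ^+ k.
Proof.
move=> lefn; rewrite /comp_poly (@nderiv_taylor_wide _ n).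
- by apply: eq_bigr => k _; rewrite nderivn_map.
- exact: mulrC.
- by rewrite (leq_trans _ lefn) // size_poly.
Qed.

Lemma comp_poly_taylor2 (f x h : {poly R}) :
  exists c, f \Po (x + h) = (f \Po x) + (f^`() \Po x) * h + c * h ^+ 2.
Proof.
rewrite (comp_poly_taylor x h (leqW (leqnSn (size f)))) !big_ord_recl /=.
rewrite nderivn0 nderivn1 expr0 mulr1 expr1 addrA.
exists (\sum_(i < size f) (f^`N(i.+2) \Po x) * h ^+ i).
congr (_ + _); rewrite mulr_suml; apply: eq_bigr => i _.
by rewrite -mulrA -exprD addn2.
Qed.

Lemma eqmodX_Hmx n g (f : 'M[{poly R}]_g) x y :
  eqmodX n x y -> eqmodX n (Hmx f x) (Hmx f y).
Proof.
case=> C ->; apply/eqmodXP=> i j d ltdn; rewrite !mxE.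
have [c ->] := comp_poly_taylor2 (f i j) (y j 0) ('X^n * C j 0).
rewrite exprMn [_ * (_ * _)]mulrCA [c * _]mulrCA expr2 -mulrA -addrA -mulrDr.
by rewrite coefD coefXnM ltdn addr0.
Qed.

(** The derivative of x |-> (f o x) x' in the direction h is ((f o x) h)': the
    term (f' o x) h x' coming from the variation of f o x is the one that the
    product rule produces.  The quadratic terms contain h h', which is why the
    congruence stops one degree before t^(2m+2). *)
Lemma separated_linearization m (f x h : {poly R}) :
  exists r, (f \Po (x + 'X^(m.+1) * h)) * (x + 'X^(m.+1) * h)^`() =
    (f \Po x) * x^`() + ((f \Po x) * ('X^(m.+1) * h))^`() + 'X^(m.*2.+1) * r.
Proof.
have [c ->] := comp_poly_taylor2 f x ('X^(m.+1) * h).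
have [w Ew] : exists w, ('X^(m.+1) * h)^`() = 'X^m * w.
  exists (h *+ m.+1 + 'X * h^`()).
  by rewrite derivM derivXn /= mulrDr exprSr mulrnAl mulrnAr mulrA.
rewrite derivD Ew derivM deriv_comp Ew.
exists ((f^`() \Po x) * h * w + c * h ^+ 2 * 'X * (x^`() + 'X^m * w)).
rewrite -addnn !(exprS _ m) (exprS _ (m + m)) exprD; ring.
Qed.

Lemma Hmx_linearization m g (f : 'M[{poly R}]_g) x h : eqmodX m.+1 h 0 ->
  eqmodX m.*2.+1 (Hmx f (x + h) *m map_mx (@deriv R) (x + h))
    (Hmx f x *m map_mx (@deriv R) x + map_mx (@deriv R) (Hmx f x *m h)).
Proof.
case=> C ->; rewrite add0r; apply/eqmodXP=> i j d ltdm; rewrite !mxE.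
rewrite raddf_sum !coefD !coef_sum -big_split /=; apply: eq_bigr => l _.
rewrite !mxE ord1; have [r ->] := separated_linearization m (f i l) (x l 0) (C l 0).
by rewrite coefD coefXnM ltdm addr0 coefD.
Qed.

(** Both sides are needed: the left inverse and the right inverse are propagated
    by the same identity, the error being the square of the previous one. *)
Lemma newton_inversel k n g (S H : 'M[{poly R}]_g) : (n <= k.*2)%N ->
  eqmodX k (H *m S) 1%:M ->
  eqmodX n (map_mx (take_poly n) (H *+ 2 - H *m S *m H) *m S) 1%:M.
Proof.
move=> len2k inv; apply: (eqmodX_trans (eqmodXM (eqmodX_take _ _) (eqmodX_refl _ _))).
have := eqmodXD inv (eqmodX_refl k (- 1%:M)); rewrite subrr => inv0.
have := eqmodXN (eqmodXM0 inv0 inv0); rewrite addnn => /(eqmodX_leq len2k) sq0.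
have := eqmodXD sq0 (eqmodX_refl n 1%:M); rewrite oppr0 add0r.
rewrite mulmxBl !mulmxBr mulmx1 !mul1mx mulmxA mulr2n !mulmxDl mulNmx.
by rewrite !opprB addrAC subrK addrA.
Qed.

Lemma newton_inverser k n g (S H : 'M[{poly R}]_g) : (n <= k.*2)%N ->
  eqmodX k (S *m H) 1%:M ->
  eqmodX n (S *m map_mx (take_poly n) (H *+ 2 - H *m S *m H)) 1%:M.
Proof.
move=> len2k inv; apply: (eqmodX_trans (eqmodXM (eqmodX_refl _ _) (eqmodX_take _ _))).
have := eqmodXD inv (eqmodX_refl k (- 1%:M)); rewrite subrr => inv0.
have := eqmodXN (eqmodXM0 inv0 inv0); rewrite addnn => /(eqmodX_leq len2k) sq0.
have := eqmodXD sq0 (eqmodX_refl n 1%:M); rewrite oppr0 add0r.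
rewrite mulmxBl !mulmxBr mulmx1 !mul1mx mulr2n !mulmxDr !mulmxA.
by rewrite !opprB addrAC subrK addrA.
Qed.

(** With h = y - x, the choice of H gives H_f(x) h = E up to t^(n+1), so the
    linearization yields S(y) = S(x) + E' = G, where S(x) = H_f(x) x'.
    Over a ring where some integers are zero divisors there are many vectors E
    with the prescribed derivative, and any of them that vanishes to order m+1
    works. *)
Lemma newton_solution m n g (f : 'M[{poly R}]_g) (G x y E : 'cV_g) (H : 'M_g) :
    (m <= n <= m.*2.+1)%N -> eqmodX m.+1 (Hmx f x *m H) 1%:M ->
    eqmodX m.+1 E 0 ->
    eqmodX n (map_mx (@deriv R) E) (G - Hmx f x *m map_mx (@deriv R) x) ->
    eqmodX n.+1 y (x + H *m E) ->
  eqmodX m.+1 y x /\ eqmodX n (Hmx f y *m map_mx (@deriv R) y) G.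
Proof.
move=> /andP[lemn len2m] inv E0 dE Ey.
have HE0 : eqmodX m.+1 (H *m E) 0.
  by rewrite -(mulmx0 _ H); apply: eqmodXM => //; apply: eqmodX_refl.
have Eyx : eqmodX m.+1 y x.
  apply: (eqmodX_trans (eqmodX_leq _ Ey)) => //.
  by rewrite -[X in eqmodX _ _ X]addr0; apply: eqmodXD => //; apply: eqmodX_refl.
split=> //; pose h := y - x; have -> : y = x + h by rewrite addrC subrK.
have h0 : eqmodX m.+1 h 0.
  by rewrite -(subrr x); apply: eqmodXD => //; apply: eqmodX_refl.
apply: (eqmodX_trans (eqmodX_leq len2m (Hmx_linearization f x h0))).
have ShE : eqmodX n.+1 (Hmx f x *m h) E.
  have Eh : eqmodX n.+1 h (H *m E).
    have := eqmodXD Ey (eqmodX_refl n.+1 (- x)).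
    by rewrite [x + _]addrC addrK.
  apply: (eqmodX_trans (eqmodXM (eqmodX_refl _ _) Eh)).
  have inv0 := eqmodXD inv (eqmodX_refl m.+1 (- 1%:M)); rewrite subrr in inv0.
  have := eqmodXM0 inv0 E0; rewrite mulmxBl mul1mx => eq0.
  have {}eq0 : eqmodX n.+1 (Hmx f x *m H *m E - E) 0.
    by apply: (eqmodX_leq _ eq0); rewrite addnS addSn addnn ltnS.
  by have := eqmodXD eq0 (eqmodX_refl _ E); rewrite subrK add0r mulmxA.
have := eqmodXD (eqmodX_refl n (Hmx f x *m map_mx (@deriv R) x))
          (eqmodX_trans (eqmodX_deriv ShE) dE).
by rewrite [X in eqmodX _ _ X]addrC subrK.
Qed.

End TruncatedCongruence.
(** * Nondeterministic computations *)

Section Outcomes.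

(** Total correctness: no error, some outcome, and only good outcomes. *)
Definition sound T (m : outcomes T) (P : T -> Prop) :=
  [/\ ~ m None, exists x, m (Some x) & forall x, m (Some x) -> P x].

Lemma sound_ret T (x : T) (P : T -> Prop) : P x -> sound (ret x) P.
Proof. by move=> Px; split=> [//||_ [->] //]; exists x. Qed.

Lemma sound_choose T (P : T -> Prop) : (exists x, P x) -> sound (Defs.choose P) P.
Proof.
by move=> [x Px]; split=> [[]//||_ [y Py [->]] //]; exists x; exists x.
Qed.

Lemma sound_bind T U (m : outcomes T) (k : T -> outcomes U) P Q :
  sound m P -> (forall x, P x -> sound (k x) Q) -> sound (bind m k) Q.
Proof.
move=> [mN [x mx] mP] kQ; split.
- by case=> [[]//|[y /mP Py]]; case: (kQ y Py).
- by have [_ [y ky] _] := kQ x (mP x mx); exists y; right; exists x.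
- by move=> y [[]//|[z /mP Pz kz]]; have [_ _] := kQ z Pz; apply.
Qed.

Lemma sound_weaken T (m : outcomes T) (P Q : T -> Prop) :
  sound m P -> (forall x, P x -> Q x) -> sound m Q.
Proof. by case=> mN mS mP PQ; split=> // x /mP /PQ. Qed.

Lemma sound_iff T (m m' : outcomes T) P :
  (forall o, m o <-> m' o) -> sound m P -> sound m' P.
Proof.
move=> mm' [mN [x mx] mP]; split; first by move/mm'.
  by exists x; apply/mm'.
by move=> y /mm' /mP.
Qed.

End Outcomes.

(** * Gauss-Jordan elimination over a local ring *)

Section Elimination.
Variables (A : comNzRingType) (av : A -> \bar rat).

(** The second clause, on zero numerators, is what keeps the coefficients that
    vanish in the ring equal to zero after a division by a zero divisor. *)
Lemma sound_fdivs (I : Type) (x y : I -> A) :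
  (forall i, (av (y i) <= av (x i))%E /\ exists z, x i = y i * z) ->
  sound (fdivs av x y) (fun z => forall i, x i = y i * z i /\ (x i = 0 -> z i = 0)).
Proof.
move=> dvd; split=> /=.
- by case=> i /=; have [le_yx _] := dvd i; rewrite ltNge le_yx.
- have /choice[z zP] : forall i, exists z, fdiv av (x i) (y i) (Some z).
    move=> i; have [le_yx [z xE]] := dvd i; rewrite /fdiv.
    by case: eqP => [_|_]; [exists 0 | exists z].
  by exists z.
- move=> z zP i; have := zP i; rewrite /fdiv; case: eqP => [-> ->|x0 [_ xE]].
    by rewrite mulr0.
  by split=> // /x0.
Qed.

Hypotheses (av_ge0 : forall x, (0 <= av x)%E) (av1 : av 1 = 0%E).
Hypotheses (av0 : (0 < av 0)%E).
Hypothesis av_unit : forall x, av x = 0%E -> exists y, x * y = 1.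
Hypothesis av_addr : forall x y, (0 < av x)%E -> (0 < av y)%E -> (0 < av (x + y)%R)%E.
Hypothesis av_mull : forall x y, (0 < av y)%E -> (0 < av (x * y)%R)%E.

Section Columns.
Variables (g : nat) (B B' : 'M[A]_g).
Hypothesis B'B : B' *m B = 1%:M.

(** Row operations turn (B | 1) into (Q B | Q) with Q invertible. *)
Definition gauss_inv (k : nat) (S : 'M[A]_(g, g + g)) :=
  [/\ lsubmx S = rsubmx S *m B, exists W, W *m rsubmx S = 1%:M
    & forall i l : 'I_g, (l < k)%N -> lsubmx S i l = (i == l)%:R].

(** If all the entries of column j on or below the diagonal were in the maximal
    ideal, so would be the entry (j, j) of V L: the earlier columns of L being
    unit vectors, the entries V j r with r < j vanish. *)
Lemma unit_pivot (j : 'I_g) (L V : 'M[A]_g) : V *m L = 1%:M ->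
  (forall i l : 'I_g, (l < j)%N -> L i l = (i == l)%:R) ->
  exists2 r : 'I_g, (j <= r)%N & av (L r j) = 0%E.
Proof.
move=> VL unitL; apply: contrapT => noPivot.
have pos (r : 'I_g) : (j <= r)%N -> (0 < av (L r j))%E.
  rewrite lt_neqAle av_ge0 andbT eq_sym => le_jr.
  by apply/eqP => Lr0; apply: noPivot; exists r.
have : (0 < av ((V *m L) j j))%E.
  rewrite mxE; elim/big_ind: _ => [//|//|r _].
  have [le_jr|lt_rj] := leqP j r; first exact/av_mull/pos.
  have := congr1 (fun M : 'M_g => M j r) VL; rewrite !mxE (bigD1 r) //= big1 => [|s sr].
    rewrite unitL // eqxx mulr1 addr0 => ->.
    by case: eqP lt_rj => [->|_]; rewrite ?ltnn ?mul0r.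
  by rewrite unitL // (negPf sr) mulr0.
by rewrite VL mxE eqxx av1 ltxx.
Qed.

Lemma gauss_inv_xrow (j r : 'I_g) S : (j <= r)%N ->
  gauss_inv j S -> gauss_inv j (xrow j r S).
Proof.
move=> le_jr [SB [W WS] unitS].
have lE : lsubmx (xrow j r S) = tperm_mx j r *m lsubmx S.
  by rewrite xrowE mulmx_lsub.
have rE : rsubmx (xrow j r S) = tperm_mx j r *m rsubmx S.
  by rewrite xrowE mulmx_rsub.
split.
- by rewrite lE rE SB mulmxA.
- exists (W *m tperm_mx j r); rewrite rE mulmxA -(mulmxA W).
  by rewrite -perm_mxM perm.tperm2 perm_mx1 mulmx1.
- move=> i l lt_lj; have Sl k : S k (lshift g l) = (k == l)%:R by rewrite -unitS // mxE.
  rewrite !mxE Sl.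
  have nj (k : 'I_g) : (j <= k)%N -> (k == l) = false.
    by move=> lejk; apply/eqP => kl; move: lejk; rewrite kl leqNgt lt_lj.
  by case: perm.tpermP => // ->; rewrite !nj.
Qed.

(** The elimination is read backwards, T = P S for an explicit P: this avoids
    writing the inverse of the pivot. *)
Lemma gauss_inv_column (j : 'I_g) (T : 'M[A]_(g, g + g)) (u : 'I_(g + g) -> A) :
    av (T j (lshift g j)) = 0%E -> (forall l, T j l = T j (lshift g j) * u l) ->
    gauss_inv j T ->
  gauss_inv j.+1
    (\matrix_(i, l) if i == j then u l else T i l - T i (lshift g j) * u l).
Proof.
set c := lshift g j; set S := (\matrix_(i, l) _).
move=> /av_unit[w pw] uP [TB [W WT] unitT].
pose P : 'M[A]_g := \matrix_(i, k) if k == j then T i c else (i == k)%:R.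
have TE : T = P *m S.
  apply/matrixP=> i l; rewrite mxE (bigD1 j) //= !mxE !eqxx.
  have [->|ij] := eqVneq i j.
    rewrite big1 ?addr0 // => k kj.
    by rewrite !mxE (negPf kj) eq_sym (negPf kj) mul0r.
  rewrite (bigD1 i) //= big1 => [|k /andP[kj ki]].
    by rewrite !mxE (negPf ij) eqxx mul1r addr0 addrC subrK.
  by rewrite !mxE (negPf kj) eq_sym (negPf ki) mul0r.
have lE : lsubmx T = P *m lsubmx S by rewrite TE mulmx_lsub.
have rE : rsubmx T = P *m rsubmx S by rewrite TE mulmx_rsub.
have WPS : (W *m P) *m rsubmx S = 1%:M by rewrite -mulmxA -rE.
have SWP := mulmx1C WPS.
split.
- rewrite -[LHS]mul1mx -SWP -!mulmxA -lE TB rE -!mulmxA.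
  by rewrite (mulmxA P) (mulmxA W) (mulmxA W) WPS mul1mx.
- by exists (W *m P).
move=> i l; rewrite ltnS leq_eqVlt => /orP[/eqP lj|lt_lj].
  have -> : l = j by apply: val_inj.
  have uc : u c = 1 by rewrite -[LHS]mul1r -pw mulrAC -uP.
  by rewrite !mxE -/c uc mulr1 subrr; case: eqP.
have Tl k : T k (lshift g l) = (k == l)%:R by rewrite -unitT // mxE.
have jl : (j == l) = false by apply/eqP => jl; move: lt_lj; rewrite jl ltnn.
have ul : u (lshift g l) = 0.
  by rewrite -[LHS]mul1r -pw mulrAC -uP Tl jl mul0r.
by rewrite !mxE ul mulr0 subr0 Tl; case: eqP => // ->; rewrite jl.
Qed.

Lemma sound_gauss_column (j : 'I_g) S : gauss_inv j S ->
  sound (gauss_column av j S) (gauss_inv j.+1).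
Proof.
move=> invS; have [SB [W WS] unitS] := invS.
have [|r le_jr r0] := @unit_pivot j (lsubmx S) (B' *m W) _ unitS.
  by rewrite SB mulmxA -(mulmxA B') WS mulmx1.
rewrite mxE in r0.
apply: sound_bind; first by apply: sound_choose; exists r; split=> // i _; rewrite r0.
move=> s [le_js smin].
have s0 : av (S s (lshift g j)) = 0%E.
  by apply/eqP; rewrite eq_le av_ge0 andbT -r0 smin.
have invT := gauss_inv_xrow le_js invS.
have p0 : av (xrow j s S j (lshift g j)) = 0%E by rewrite mxE perm.tpermL.
have [w pw] := av_unit p0.
apply: sound_bind.
  apply: sound_fdivs => l; rewrite p0; split=> //.
  by exists (w * xrow j s S j l); rewrite mulrA pw mul1r.
move=> u uP; apply: sound_ret; apply: gauss_inv_column => // l.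
by have [] := uP l.
Qed.

Lemma sound_gauss k S : (k <= g)%N -> gauss_inv k S ->
  sound (gauss av (drop k (enum 'I_g)) S) (gauss_inv g).
Proof.
move: {2}(g - k)%N (erefl (g - k)%N) => d; elim: d k S => [|d IHd] k S gk lekg invS.
  have -> : k = g by apply/eqP; rewrite eqn_leq lekg -subn_eq0 gk.
  rewrite drop_oversize ?size_enum_ord //; apply: sound_ret.
  by move: invS; congr gauss_inv; apply/eqP; rewrite eqn_leq lekg -subn_eq0 gk.
have ltkg : (k < g)%N by rewrite -subn_gt0 gk.
rewrite (drop_nth (Ordinal ltkg)) ?size_enum_ord //=.
set j := nth _ _ _; have jk : j = k :> nat by rewrite nth_enum_ord.
apply: (@sound_bind _ _ _ _ (gauss_inv k.+1)).
  by rewrite -jk; apply: sound_gauss_column; rewrite jk.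
by move=> T invT; apply: IHd => //; rewrite subnS gk.
Qed.

Lemma sound_finvmx : sound (finvmx av B) (fun C => C *m B = 1%:M).
Proof.
apply: (@sound_bind _ _ _ _ (gauss_inv g)).
  rewrite -[enum _]drop0; apply: sound_gauss => //.
  split=> [||//]; rewrite ?row_mxKl row_mxKr ?mul1mx //.
  by exists 1%:M; rewrite mul1mx.
move=> T [TB _ unitT]; apply: sound_ret; rewrite -TB.
by apply/matrixP=> i l; rewrite unitT // [RHS]mxE.
Qed.

End Columns.
End Elimination.
(** * Primitives and Taylor's formula in characteristic zero *)

Section Primitive.
Variable K : fieldType.
Hypothesis char0 : forall k, (k.+1%:R : K) != 0.

Definition primitive (f : {poly K}) : {poly K} :=
  \poly_(i < (size f).+1) (f`_i.-1 / i%:R).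

Lemma coef_primitive f i : (primitive f)`_i = f`_i.-1 / i%:R.
Proof.
rewrite coef_poly; case: ltnP => // le_fi.
by rewrite nth_default ?mul0r // -ltnS prednK // (leq_ltn_trans _ le_fi).
Qed.

Lemma deriv_primitive f : (primitive f)^`() = f.
Proof.
by apply/polyP=> i; rewrite coef_deriv coef_primitive -[LHS]mulr_natr mulfVK.
Qed.

(** This is where the denominators k of the terms h^k / k come from: they are
    the only ones in the Taylor expansion of a primitive. *)
Lemma nderivn_primitive f k :
  (primitive f)^`N(k.+1) = (k.+1%:R)^-1 *: f^`N(k).
Proof.
apply/polyP=> i; rewrite coefZ !coef_nderivn coef_primitive addSn /=.
rewrite -[LHS]mulr_natr -(mulr_natr f`_(k + i)) mulrCA -mulrA.
have := congr1 (fun m => m%:R : K) (mul_bin_diag (k + i).+1 k).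
rewrite !natrM /= => E; congr (_ * _).
apply: (mulfI (char0 (k + i))); rewrite /= mulVKf //.
by apply: (mulfI (char0 k)); rewrite /= -E mulrCA mulVKf.
Qed.

(** The part of order at least two in h of the Taylor expansion of the primitive
    of f; the index k stands for the term in h^(k+2). *)
Definition primitive_remainder (f x h : {poly K}) :=
  \sum_(k < size f) k.+2%:R^-1 *: ((f^`N(k.+1) \Po x) * h ^+ k.+2).

Lemma primitive_comp (f x h : {poly K}) :
  (primitive f \Po (x + h)) - (primitive f \Po x) =
    (f \Po x) * h + primitive_remainder f x h.
Proof.
rewrite (@comp_poly_taylor _ _ _ _ (size f).+2); last first.
  by rewrite (leq_trans (size_poly _ _)).
rewrite !big_ord_recl /= nderivn0 expr0 mulr1 addrC addKr expr1.
rewrite nderivn1 deriv_primitive; congr (_ + _).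
by apply: eq_bigr => k _; rewrite nderivn_primitive comp_polyZ scalerAl.
Qed.

Lemma Hmx_deriv_primitive g (f : 'M[{poly K}]_g) (x : 'cV_g) i :
  (Hmx f x *m map_mx (@deriv K) x) i 0 =
  (\sum_j (primitive (f i j) \Po x j 0))^`().
Proof.
rewrite mxE raddf_sum; apply: eq_bigr => j _.
by rewrite !mxE /= deriv_comp deriv_primitive.
Qed.

End Primitive.

(** * Loss of precision in the differential equation *)

Lemma logn_le_trunc_log p d : prime p -> (0 < d)%N ->
  (logn p d <= trunc_log p d)%N.
Proof.
move=> hp d0; apply: trunc_log_max; first exact: prime_gt1.
by rewrite dvdn_leq // pfactor_dvdnn.
Qed.

Lemma logn_add_pred_le p k : prime p -> (0 < k)%N -> (0 < logn p k)%N ->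
  (p.-1 + logn p k <= k)%N.
Proof.
move=> hp k0 s0; apply: leq_trans (dvdn_leq k0 (pfactor_dvdnn p k)).
have p1 := prime_gt1 hp; case: (logn p k) s0 => // s _.
elim: s => [|s IHs]; first by rewrite expn1 addn1 prednK // prime_gt0.
rewrite expnS addnS (leq_trans (n := (p ^ s.+1).*2)) //.
  by rewrite -addnn -addn1 leq_add // expn_gt0 prime_gt0.
by rewrite -mul2n leq_mul2r p1 orbT.
Qed.

Section ValuedField.
Variables (K : fieldType) (v : valuation K) (p : nat).
Hypothesis hp : prime p.
Hypothesis v_nat : forall k, (0 < k)%N -> v k%:R = (logn p k)%:R%:E.
Implicit Types (x y : K) (B C M : rat).

Definition vge B x := (B%:E <= v x)%E.

Lemma vge0 B : vge B 0.
Proof. by rewrite /vge (val_eq_pinfty v 0).2 // leey. Qed.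

Lemma vgeW B C x : B <= C -> vge C x -> vge B x.
Proof. by move=> leBC; apply: le_trans; rewrite lee_fin. Qed.

Lemma vgeD B x y : vge B x -> vge B y -> vge B (x + y).
Proof.
by move=> Bx By; apply: le_trans (Defs.valD v x y); rewrite le_min; apply/andP.
Qed.

Lemma vgeN B x : vge B x -> vge B (- x).
Proof. by rewrite /vge Defs.valN. Qed.

Lemma vge_sum I r (P : pred I) (F : I -> K) B :
  (forall i, P i -> vge B (F i)) -> vge B (\sum_(i <- r | P i) F i).
Proof. by move=> BF; elim/big_ind: _ => //; [apply: vge0 | apply: vgeD]. Qed.

Lemma vgeM B C x y : vge B x -> vge C y -> vge (B + C) (x * y).
Proof. by move=> Bx Cy; rewrite /vge Defs.valM EFinD leeD. Qed.

Lemma vge_natV k : (0 < k)%N -> vge (- (logn p k)%:R) (k%:R^-1).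
Proof.
move=> k0; have kn0 : (k%:R : K) != 0.
  apply/eqP=> /(val_eq_pinfty v); by rewrite v_nat.
have [q Eq] : {q : rat | v (k%:R^-1) = q%:E} by apply: val_fin; rewrite invr_eq0.
have := Defs.valM v k%:R k%:R^-1; rewrite mulfV // Defs.val1 v_nat // Eq -EFinD => -[] E.
by rewrite /vge Eq lee_fin; lra.
Qed.

Lemma natr_neq0 k : (k.+1%:R : K) != 0.
Proof. by apply/eqP=> /(val_eq_pinfty v); rewrite v_nat. Qed.

Local Notation Kint := (polyOver (integral_pred v)).

Lemma vge0_coef (q : {poly K}) d : q \is a Kint -> vge 0 q`_d.
Proof. by move=> /polyOverP /(_ d). Qed.

Lemma vge_coefM B (q r : {poly K}) d : q \is a Kint ->
  (forall c, (c <= d)%N -> vge B r`_c) -> vge B (q * r)`_d.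
Proof.
move=> qI Br; rewrite coefM; apply: vge_sum => i _.
by rewrite -[B]add0r; apply: vgeM; [apply: vge0_coef | apply: Br; lia].
Qed.

(* Lower bounds of the form a - b(c) on the coefficients of degree c, with b
   superadditive, are stable under products. *)
Section Powers.
Variables (h : {poly K}) (d : nat) (a : rat) (b : nat -> nat).
Hypothesis b_superadd : forall i j, (b i + b j <= b (i + j))%N.
Hypothesis bound_h : forall c, (c < d)%N -> vge (a - (b c)%:R) h`_c.

Let vge_prod k i c : (i <= c)%N ->
  vge (a - (b i)%:R) h`_i ->
  vge (k%:R * a - (b (c - i))%:R) (h ^+ k)`_(c - i) ->
  vge (k.+1%:R * a - (b c)%:R) (h`_i * (h ^+ k)`_(c - i)).
Proof.
move=> le_ic hi hk; apply: vgeW (vgeM hi hk).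
have : ((b i)%:R + (b (c - i))%:R <= (b c)%:R :> rat).
  by rewrite -natrD ler_nat (leq_trans (b_superadd _ _)) // subnKC.
by rewrite -[k.+1]add1n natrD mulrDl mul1r; lra.
Qed.

Lemma vge_coef_exp k c : (c < d)%N -> vge (k%:R * a - (b c)%:R) (h ^+ k)`_c.
Proof.
elim: k c => [|k IHk] c lt_cd.
  rewrite expr0 coef1; case: c {lt_cd} => [|c]; last exact: vge0.
  have -> : b 0 = 0%N by have := b_superadd 0 0; rewrite add0n; lia.
  by rewrite /vge Defs.val1 mul0r subrr.
rewrite exprS coefM; apply: vge_sum => i _; have lt_ic := ltn_ord i.
by apply: vge_prod; [lia | apply: bound_h; lia | apply: IHk; lia].
Qed.

(** As h has no constant term and the exponent is at least two, the coefficient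
    of degree d of the power only involves coefficients of h of degree < d. *)
Lemma vge_coef_exp2 k c : h`_0 = 0 -> (c <= d)%N ->
  vge (k.+2%:R * a - (b c)%:R) (h ^+ k.+2)`_c.
Proof.
move=> h0 le_cd; rewrite exprS coefM; apply: vge_sum => i _.
have lt_ic := ltn_ord i.
have [->|i0] := posnP i; first by rewrite h0 mul0r; apply: vge0.
have [ltic|leci] := ltnP i c.
  apply: vge_prod; [lia | apply: bound_h; lia | apply: vge_coef_exp; lia].
have -> : (c - i = 0)%N by lia.
by rewrite exprS coef0M h0 mul0r mulr0; apply: vge0.
Qed.

End Powers.

(** Let l = floor(log_p d).  If p does not divide the exponent, all the
    coefficients have valuation at least M - l >= 0 and this suffices.
    Otherwise, a coefficient of degree c has valuation at least
    M - l + 1 - floor(c / p^l); the total defect is at most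
    floor(d / p^l) <= p - 1, and an exponent k divisible by p satisfies
    k - (p - 1) >= v(k). *)
Lemma vge_coef_exp_div (h : {poly K}) d M k c : h`_0 = 0 ->
    (trunc_log p d)%:R <= M ->
    (forall c, (0 < c < d)%N -> vge (M - (trunc_log p c)%:R) h`_c) ->
    (c <= d)%N ->
  vge (M - (trunc_log p d)%:R) (k.+2%:R^-1 * (h ^+ k.+2)`_c).
Proof.
move=> h0; set l := trunc_log p d => leM hB le_cd; set a := M - l%:R.
have a0 : 0 <= a by rewrite subr_ge0.
have p1 := prime_gt1 hp.
have le_l c' : (c' < d)%N -> (trunc_log p c' <= l)%N.
  by move=> lt_cd; apply: leq_trunc_log; apply: ltnW.
have kV := @vge_natV k.+2 isT.
have ka : a <= k.+2%:R * a.
  by rewrite -subr_ge0 -[X in _ - X]mul1r -mulrBl mulr_ge0 // subr_ge0 ler1n.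
have [s0|s0] := posnP (logn p k.+2).
  have bd c' : (c' < d)%N -> vge (a - 0%:R) h`_c'.
    move=> lt_cd; have [->|c0] := posnP c'; first by rewrite h0; apply: vge0.
    apply: vgeW (hB c' _); rewrite ?c0 // subr0 lerB // ler_nat; exact: le_l.
  have := @vge_coef_exp2 h d a (fun=> 0%N) (fun _ _ => leqnn _) bd k c h0 le_cd.
  by move=> /(vgeM kV); apply: vgeW; rewrite s0; lra.
pose q := (p ^ l)%N; have q0 : (0 < q)%N by rewrite expn_gt0 prime_gt0.
have bS i j : (i %/ q + j %/ q <= (i + j) %/ q)%N by rewrite divnD // leq_addr.
have bd c' : (c' < d)%N -> vge (a + 1 - (c' %/ q)%:R) h`_c'.
  move=> lt_cd; have [->|c0] := posnP c'; first by rewrite h0; apply: vge0.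
  apply: vgeW (hB c' _); rewrite ?c0 //.
  have [lt_cq|le_qc] := ltnP c' q.
    rewrite divn_small // subr0.
    suff : ((trunc_log p c').+1 <= l)%N.
      by rewrite -(ler_nat rat) -natr1 /a; lra.
    by rewrite -(ltn_exp2l _ _ p1); apply: leq_ltn_trans lt_cq; apply: trunc_logP.
  have : (1 <= (c' %/ q)%:R :> rat) by rewrite ler1n divn_gt0.
  have := le_l _ lt_cd; rewrite -(ler_nat rat) /a; lra.
have := @vge_coef_exp2 h d _ _ bS bd k c h0 le_cd.
move=> /(vgeM kV); apply: vgeW; rewrite mulrDr mulr1.
have : (c %/ q <= p.-1)%N.
  rewrite -ltnS prednK ?prime_gt0 // ltn_divLR // -expnS.
  by rewrite (leq_ltn_trans le_cd) // trunc_log_ltn.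
have := logn_add_pred_le hp (isT : (0 < k.+2)%N) s0.
rewrite -!(ler_nat rat) natrD; lra.
Qed.

Lemma vge_primitive_remainder (f x h : {poly K}) d M c :
    f \is a Kint -> x \is a Kint -> h`_0 = 0 ->
    (trunc_log p d)%:R <= M ->
    (forall c, (0 < c < d)%N -> vge (M - (trunc_log p c)%:R) h`_c) ->
    (c <= d)%N ->
  vge (M - (trunc_log p d)%:R) (primitive_remainder f x h)`_c.
Proof.
move=> fI xI h0 leM hB le_cd; rewrite coef_sum; apply: vge_sum => k _.
rewrite scalerAr; apply: vge_coefM.
  by apply: polyOver_comp => //; apply: polyOver_nderivn.
by move=> c' le_c'; rewrite coefZ; apply: vge_coef_exp_div => //; lia.
Qed.

Section Perturbation.
Variables (g : nat) (f : 'M[{poly K}]_g) (x X : 'cV[{poly K}]_g).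
Variables (B : 'M[K]_g) (M : rat).
Hypothesis f_int : forall i j, f i j \is a Kint.
Hypothesis x_int : forall j, x j 0 \is a Kint.
Hypothesis X_int : forall j, X j 0 \is a Kint.
Hypotheses (x0 : forall j, (x j 0)`_0 = 0) (X0 : forall j, (X j 0)`_0 = 0).

Let defect Y i : {poly K} := (Hmx f Y *m map_mx (@deriv K) Y
  - Hmx f x *m map_mx (@deriv K) x) i 0.

Let coef_defect Y i d :
  (defect Y i)`_d = (\sum_j ((f i j \Po x j 0) * (Y - x) j 0
     + primitive_remainder (f i j) (x j 0) ((Y - x) j 0)))`_d.+1 * d.+1%:R.
Proof.
have subE (U V : 'cV[{poly K}]_g) : (U - V) i 0 = U i 0 - V i 0 by rewrite !mxE.
rewrite /defect subE.
rewrite !(Hmx_deriv_primitive natr_neq0) -derivB -sumrB coef_deriv -[LHS]mulr_natr.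
congr (nth _ (polyseq _) _ * _); apply: eq_bigr => j _.
by rewrite -(primitive_comp natr_neq0) !mxE [_ + (_ - _)]addrC subrK.
Qed.

(** Induction on the degree: in degree d+1, the defect determines f(0) h_(d+1)
    up to terms involving only h_1, ..., h_d. *)
Lemma precision_loss m :
    (forall i j, vge 0 (B i j)) ->
    B *m (\matrix_(i, j) (f i j)`_0) = 1%:M ->
    (trunc_log p m)%:R <= M ->
    (forall i d, (d < m)%N -> vge M (defect X i)`_d) ->
  forall j c, (c <= m)%N -> vge (M - (trunc_log p c)%:R) ((X - x) j 0)`_c.
Proof.
move=> B_int Bf leM defM j c; elim/ltn_ind: c j => -[|d] IHd j le_cm.
  by rewrite !mxE coefB X0 x0 subrr; apply: vge0.
have leMd : (trunc_log p d.+1)%:R <= M.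
  by apply: le_trans leM; rewrite ler_nat leq_trunc_log.
set L := M - _; pose y : 'cV[K]_g := \col_j ((X - x) j 0)`_d.+1.
pose z := (\matrix_(i, j) (f i j)`_0) *m y.
have hB j' c : (0 < c < d.+1)%N ->
    vge (M - (trunc_log p c)%:R) ((X - x) j' 0)`_c.
  by move=> /andP[_ lt_cd]; apply: IHd => //; lia.
suff zL i : vge L (z i 0).
  have -> : ((X - x) j 0)`_d.+1 = (B *m z) j 0.
    by rewrite mulmxA Bf mul1mx [RHS]mxE.
  rewrite mxE; apply: vge_sum => i _.
  by rewrite -[L]add0r; apply: vgeM (B_int _ _) (zL i).
have : vge L ((defect X i)`_d / d.+1%:R).
  apply: vgeW (vgeM (defM i d _) (vge_natV (ltn0Sn d))) => //.
  by rewrite lerB // ler_nat logn_le_trunc_log.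
rewrite coef_defect mulfK ?natr_neq0 // coef_sum => defL.
pose r j := ((f i j \Po x j 0) * ((X - x) j 0))`_d.+1 - (f i j)`_0 * y j 0
  + (primitive_remainder (f i j) (x j 0) ((X - x) j 0))`_d.+1.
(* [r j] is what the coefficient of degree d+1 contains besides f(0) h_(d+1). *)
have -> : z i 0 = \sum_j ((f i j \Po x j 0) * ((X - x) j 0) +
   primitive_remainder (f i j) (x j 0) ((X - x) j 0))`_d.+1 - \sum_j r j.
  rewrite -sumrB mxE; apply: eq_bigr => j' _; rewrite coefD /r mxE.
  by set u := _`_d.+1; set w := _`_d.+1; ring.
apply: vgeD => //; apply: vgeN; apply: vge_sum => j' _; apply: vgeD; last first.
  apply: vge_primitive_remainder => //; last by move=> c; apply: hB.
  by rewrite !mxE coefB X0 x0 subrr.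
have fx0 : (f i j' \Po x j' 0)`_0 = (f i j')`_0.
  by rewrite -horner_coef0 horner_comp (horner_coef0 (x j' 0)) x0 horner_coef0.
rewrite coefM big_ord_recl subn0 [y _ _]mxE fx0 addrAC subrr add0r.
apply: vge_sum => c _; rewrite -[L]add0r; apply: vgeM.
  by apply: vge0_coef; apply: polyOver_comp.
have lt_cd := ltn_ord c; rewrite subSS.
have [->|c0] := posnP (d - c).
  by rewrite !mxE coefB X0 x0 subrr; apply: vge0.
apply: vgeW (hB j' (d - c)%N _); last by apply/andP; split=> //; lia.
by rewrite lerB // ler_nat leq_trunc_log //; lia.
Qed.

(** Split X = x + a + b with a of degree at most m and b divisible by t^(m+1).
    Replacing x + a by X adds a derivative of an integral polynomial, by
    linearization; replacing x by x + a is Taylor's formula, where a has the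
    precision that makes the quotients a^k / k integral. *)
Lemma defect_integrable m n : (m <= n <= m.*2.+1)%N ->
    (trunc_log p n)%:R <= M ->
    (forall j c, (c <= m)%N -> vge (M - (trunc_log p c)%:R) ((X - x) j 0)`_c) ->
  forall i d, (d < n)%N -> vge 0 ((defect X i)`_d / d.+1%:R).
Proof.
move=> /andP[lemn len2m] leM hB i d lt_dn.
pose a : 'cV[{poly K}]_g := map_mx (take_poly m.+1) (X - x).
pose X1 := x + a; pose b := X - X1.
have aE j c : (a j 0)`_c = if (c < m.+1)%N then ((X - x) j 0)`_c else 0.
  by rewrite mxE coef_take_poly.
have Xx_int j : (X - x) j 0 \is a Kint by rewrite !mxE rpredB.
have a_int j : a j 0 \is a Kint.
  apply/polyOverP=> c; rewrite aE; case: ifP => _; last exact: rpred0.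
  exact: (polyOverP (Xx_int j)).
have X1_int j : X1 j 0 \is a Kint by rewrite mxE rpredD.
have b0 : eqmodX m.+1 b 0.
  have -> : b = (X - x) - a by rewrite /b opprD addrA.
  rewrite -(subrr (X - x)); apply: eqmodXD; first exact: eqmodX_refl.
  by apply: eqmodXN; apply: eqmodX_take.
have := Hmx_linearization f X1 b0; rewrite [X1 + b]addrC subrK => /eqmodXP lin.
have addE (U V : 'cV[{poly K}]_g) : (U + V) i 0 = U i 0 + V i 0 by rewrite mxE.
have oppE (U : 'cV[{poly K}]_g) : (- U) i 0 = - U i 0 by rewrite mxE.
have derE (U : 'cV[{poly K}]_g) :
    (map_mx (@deriv K) U i 0)`_d = (U i 0)`_d.+1 * d.+1%:R.
  by rewrite mxE coef_deriv -[LHS]mulr_natr.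
have -> : (defect X i)`_d = ((Hmx f X1 *m b) i 0)`_d.+1 * d.+1%:R + (defect X1 i)`_d.
  rewrite /defect !addE oppE !coefB lin; last exact: leq_trans len2m.
  by rewrite addE coefD derE addrAC addrC.
rewrite coef_defect -mulrDl mulfK ?natr_neq0 //; apply: vgeD.
  apply: vge0_coef; rewrite mxE rpred_sum // => j _; rewrite mxE rpredM //.
    exact: polyOver_comp.
  have -> : b j 0 = X j 0 - X1 j 0 by rewrite !mxE.
  exact: rpredB.
rewrite coef_sum; apply: vge_sum => j _.
have -> : X1 - x = a by rewrite addrC addKr.
rewrite coefD; apply: vgeD.
  by apply: vge0_coef; rewrite rpredM // polyOver_comp.
apply: vgeW (vge_primitive_remainder (d := n) (M := M) _ _ _ _ _ _) => //.
- by rewrite subr_ge0.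
- by rewrite aE !mxE coefB X0 x0 subrr.
by move=> c _; rewrite aE ltnS; case: leqP => [/hB //|_]; apply: vge0.
Qed.

End Perturbation.
End ValuedField.
(** * The ring of integers modulo a power of the uniformizer *)

Section FixedPoint.
Variables (K : fieldType) (v : valuation K) (p : nat).
Hypothesis v_p : v p%:R = 1%:E.
Variables (pi : uniformizer v) (e : nat).
Hypothesis he : is_ramification_index p pi e.
Local Notation OK := (ringOfIntegers v).

Lemma int_val_inj : injective (@int_val K v).
Proof. exact: val_inj. Qed.

Lemma int_valM (x y : OK) : int_val (x * y) = int_val x * int_val y.
Proof. exact: (rmorphM val). Qed.

Lemma int_valD (x y : OK) : int_val (x + y) = int_val x + int_val y.
Proof. exact: (rmorphD val). Qed.

Lemma int_valB (x y : OK) : int_val (x - y) = int_val x - int_val y.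
Proof. exact: (rmorphB val). Qed.

Lemma int_valX (x : OK) m : int_val (x ^+ m) = int_val x ^+ m.
Proof. exact: (rmorphXn val). Qed.

Lemma int_val_nat m : int_val (m%:R : OK) = m%:R.
Proof. exact: (rmorph_nat val). Qed.

Lemma int_val1 : int_val (1 : OK) = 1.
Proof. exact: (rmorph1 val). Qed.

Lemma ringOfIntegersE (x : K) : vge v 0 x -> {y : OK | int_val y = x}.
Proof. by move=> x0; exists (RingOfIntegers (x0 : x \in integral_pred v)). Qed.

Lemma vge_val (x : OK) : vge v 0 (int_val x).
Proof. by case: x. Qed.

Lemma unif_val_spec : exists2 q : rat, e%:R * q = 1
  & forall m, v (int_val ((pi : OK) ^+ m)) = (m%:R * q)%:E.
Proof.
have [u [vu pE]] := he.
have {}pE : p%:R = int_val u * int_val (pi : OK) ^+ e.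
  by rewrite -int_valX -int_valM -pE int_val_nat.
have v_exp q : v (int_val (pi : OK)) = q%:E ->
    forall m, v (int_val (pi : OK) ^+ m) = (m%:R * q)%:E.
  move=> vq; elim=> [|m IHm]; first by rewrite expr0 mul0r Defs.val1.
  by rewrite exprS Defs.valM IHm vq -EFinD -[m.+1]add1n natrD mulrDl mul1r.
have pi0 : int_val (pi : OK) != 0.
  apply: contra_eq_neq v_p => pi0; rewrite pE pi0.
  have [->|e0] := posnP e; last first.
    by rewrite -(prednK e0) exprS mul0r mulr0 (val_eq_pinfty v 0).2.
  by rewrite expr0 mulr1 [v _]vu; apply/eqP => -[] /eqP.
have [q vq] := val_fin v pi0; exists q; last first.
  by move=> m; rewrite int_valX; apply: v_exp.
have := v_p; rewrite pE Defs.valM [v (int_val u)]vu (v_exp q vq) add0e.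
by case.
Qed.

Lemma ramif_gt0 : (0 < e%:R :> rat).
Proof.
have [q eq _] := unif_val_spec; rewrite ltr0n lt0n; apply/eqP => e0.
by move/eqP: eq; rewrite e0 mul0r.
Qed.

Lemma val_unif_exp m : v (int_val ((pi : OK) ^+ m)) = (m%:R / e%:R)%:E.
Proof.
have [q eq ->] := unif_val_spec; congr (_ * _)%:E.
by apply: (mulfI (lt0r_neq0 ramif_gt0)); rewrite eq mulfV ?lt0r_neq0 ?ramif_gt0.
Qed.

Lemma dvd_unifP (x : OK) m :
  vge v (m%:R / e%:R) (int_val x) <-> exists z, x = (pi : OK) ^+ m * z.
Proof.
split=> [xm|[z ->]]; last first.
  by rewrite int_valM -[_ / _]addr0; apply: vgeM (vge_val z); rewrite /vge val_unif_exp.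
set w := int_val ((pi : OK) ^+ m).
have w0 : w != 0.
  by apply/eqP=> /(val_eq_pinfty v); rewrite val_unif_exp.
have [z zE] : {z : OK | int_val z = int_val x / w}.
  apply: ringOfIntegersE; have [q Eq] := val_fin v (invr_neq0 w0).
  have := Defs.valM v w w^-1; rewrite mulfV // Defs.val1 val_unif_exp Eq -EFinD => -[] E.
  have : vge v q w^-1 by rewrite /vge Eq.
  by move=> /(vgeM xm); apply: vgeW; lra.
by exists z; apply: int_val_inj; rewrite int_valM zE mulrC divfK.
Qed.

Section Quotient.
Variable k : nat.
Hypothesis k_gt0 : (0 < k)%N.
Local Notation A := (fixp pi k).
Local Notation av := (@fixp_val K v pi k).

Lemma pi_fixpM (x y : OK) : \pi_A (x * y) = \pi_A x * \pi_A y.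
Proof. exact: (rmorphM (\pi_A)). Qed.

Lemma pi_fixpD (x y : OK) : \pi_A (x + y) = \pi_A x + \pi_A y.
Proof. exact: (rmorphD (\pi_A)). Qed.

Lemma pi_fixpB (x y : OK) : \pi_A (x - y) = \pi_A x - \pi_A y.
Proof. exact: (rmorphB (\pi_A)). Qed.

Lemma pi_fixp_nat m : \pi_A (m%:R : OK) = m%:R.
Proof. exact: (rmorph_nat (\pi_A)). Qed.

Lemma pi_fixp1 : \pi_A (1 : OK) = 1.
Proof. exact: (rmorph1 (\pi_A)). Qed.

Lemma pi_fixp_eq0 (x : OK) :
  \pi_A x = 0 <-> vge v (k%:R / e%:R) (int_val x).
Proof.
rewrite dvd_unifP -[0](rmorph0 (\pi_A)).
split=> [/eqP|[z xE]]; last apply/eqP.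
  rewrite -Quotient.idealrBE subr0 => /asboolP[z ->].
  by exists z; rewrite prednK.
rewrite -Quotient.idealrBE subr0; apply/asboolP.
by exists z; rewrite prednK.
Qed.

(** The valuation does not depend on the lift, since a nonzero class has a
    valuation smaller than that of pi^k. *)
Lemma fixp_valE (x : OK) :
  av (\pi_A x) = if \pi_A x == 0 then +oo%E else v (int_val x).
Proof.
rewrite /fixp_val; case: ifPn => // x0.
have val_le (y z : OK) : \pi_A y = \pi_A z -> \pi_A z != 0 ->
    (v (int_val z) <= v (int_val y))%E.
  move=> yz z0; rewrite -[int_val y](subrK (int_val z)).
  apply: le_trans (Defs.valD v _ _); rewrite le_min lexx andbT.
  apply: (@le_trans _ _ (k%:R / e%:R)%:E).
    by rewrite leNgt; apply: contraNN z0 => /ltW zk; apply/eqP/pi_fixp_eq0.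
  by rewrite -int_valB; apply/pi_fixp_eq0; rewrite pi_fixpB yz subrr.
by apply/eqP; rewrite eq_le !val_le // reprK.
Qed.

Lemma fixp_val_ge0 a : (0 <= av a)%E.
Proof. by rewrite -[a]reprK fixp_valE; case: eqP => // _; apply: vge_val. Qed.

Lemma fixp_val1 : av 1 = 0%E.
Proof.
by rewrite -pi_fixp1 fixp_valE pi_fixp1 oner_eq0 int_val1 Defs.val1.
Qed.

Lemma fixp_val0 : (0 < av 0%R)%E.
Proof. by rewrite /fixp_val eqxx. Qed.

Lemma fixp_val_gt0 (x : OK) : (0 < av (\pi_A x))%E <-> (0 < v (int_val x))%E.
Proof.
rewrite fixp_valE; case: eqP => // /pi_fixp_eq0 xk; split=> // _.
by apply: lt_le_trans xk; rewrite lte_fin divr_gt0 ?ramif_gt0 ?ltr0n.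
Qed.

Lemma fixp_val_unit a : av a = 0%E -> exists b, a * b = 1.
Proof.
rewrite -[a]reprK fixp_valE; case: eqP => // _; set x := repr a => vx.
have x0 : int_val x != 0 by apply/eqP=> /(val_eq_pinfty v); rewrite vx.
have [y yE] : {y : OK | int_val y = (int_val x)^-1}.
  apply: ringOfIntegersE; have := Defs.valM v (int_val x) (int_val x)^-1.
  by rewrite mulfV // Defs.val1 vx add0e /vge => <-.
exists (\pi_A y); rewrite -pi_fixpM -pi_fixp1; congr (\pi_A _).
by apply: int_val_inj; rewrite int_valM yE mulfV // int_val1.
Qed.

Lemma fixp_val_addr a b :
  (0 < av a)%E -> (0 < av b)%E -> (0 < av (a + b)%R)%E.
Proof.
rewrite -[a]reprK -[b]reprK -pi_fixpD => /fixp_val_gt0 a0 /fixp_val_gt0 b0.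
apply/fixp_val_gt0; rewrite int_valD; apply: lt_le_trans (Defs.valD v _ _).
by rewrite lt_min; apply/andP.
Qed.

Lemma fixp_val_mull a b : (0 < av b)%E -> (0 < av (a * b)%R)%E.
Proof.
rewrite -[a]reprK -[b]reprK -pi_fixpM => /fixp_val_gt0 b0.
apply/fixp_val_gt0; rewrite int_valM Defs.valM.
by apply: lt_le_trans b0 _; rewrite leeDr //; apply: vge_val.
Qed.

(** Divisibility of some lift suffices, even when d+1 vanishes in the quotient:
    then the numerator vanishes as well. *)
Lemma fixp_dvd_nat (x : OK) d : (d.+1%:R : K) != 0 ->
    vge v 0 (int_val x / d.+1%:R) ->
  (av d.+1%:R <= av (\pi_A x))%E /\ exists z, \pi_A x = d.+1%:R * z.
Proof.
move=> d0 /ringOfIntegersE[z zE].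
have xE : x = d.+1%:R * z.
  by apply: int_val_inj; rewrite int_valM int_val_nat zE mulrC divfK.
split; last by exists (\pi_A z); rewrite xE pi_fixpM pi_fixp_nat.
rewrite -pi_fixp_nat !fixp_valE.
case: (\pi_A x =P 0) => [_|x0]; first exact: leey.
case: eqP => [d0'|_]; first by case: x0; rewrite xE pi_fixpM d0' mul0r.
by rewrite [in X in (_ <= X)%E]xE int_valM int_val_nat Defs.valM leeDl //; apply: vge_val.
Qed.

End Quotient.
End FixedPoint.
(** * Correctness of the iteration over an abstract fixed point ring *)

Section Maps.
Variables (R S : comNzRingType) (phi : {rmorphism R -> S}).

Lemma map_Hmx g (f : 'M[{poly R}]_g) (x : 'cV_g) :
  map_mx (map_poly phi) (Hmx f x) =
  Hmx (map_mx (map_poly phi) f) (map_mx (map_poly phi) x).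
Proof. by apply/matrixP=> i j; rewrite !mxE map_comp_poly. Qed.

Lemma map_diff_op g (f : 'M[{poly R}]_g) (x : 'cV_g) :
  map_mx (map_poly phi) (Hmx f x *m map_mx (@deriv R) x) =
  Hmx (map_mx (map_poly phi) f) (map_mx (map_poly phi) x)
    *m map_mx (@deriv S) (map_mx (map_poly phi) x).
Proof.
rewrite map_mxM map_Hmx; congr (_ *m _).
by apply/matrixP=> i j; rewrite !mxE deriv_map.
Qed.

End Maps.

Section FixedPointIntegration.
Variables (A : comNzRingType) (av : A -> \bar rat).

Lemma sound_fintegral g n (Y : 'cV[{poly A}]_g) :
    (forall i d, (d < n)%N -> (av d.+1%:R <= av (Y i 0)`_d)%E /\
       exists z, (Y i 0)`_d = d.+1%:R * z) ->
  sound (fintegral av n Y) (fun E =>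
    [/\ forall i, (E i 0)`_0 = 0, eqmodX n (map_mx (@deriv A) E) Y
      & forall m, (m <= n)%N -> eqmodX m Y 0 -> eqmodX m.+1 E 0]).
Proof.
move=> dvdY; apply: sound_bind.
  by apply: sound_fdivs => -[i d] /=; apply: dvdY.
move=> q qP; apply: sound_ret.
set E := \col_a _.
have E0 i : (E i 0)`_0 = 0.
  by rewrite mxE coef_sum big1 // => d _; rewrite coefZ coefXn mulr0.
have ES i (d : 'I_n) : (E i 0)`_d.+1 = q (i, d).
  rewrite mxE coef_sum (bigD1 d) //= big1 ?addr0 => [|c cd].
    by rewrite coefZ coefXn eqxx mulr1.
  rewrite coefZ coefXn eqSS; case: eqP => [dc|_]; last by rewrite mulr0.
  by case/eqP: cd; apply: val_inj.
split=> [//||m lemn /eqmodXP Y0]; apply/eqmodXP=> i j d ltd; rewrite ?ord1.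
  rewrite mxE coef_deriv (ES i (Ordinal ltd)) -[LHS]mulr_natr mulrC.
  by have [/= <-] := qP (i, Ordinal ltd).
rewrite [in RHS]mxE coef0; case: d ltd => [_|d ltdm]; first exact: E0.
have ltdn : (d < n)%N by lia.
rewrite (ES i (Ordinal ltdn)).
by have [_] := qP (i, Ordinal ltdn); apply; rewrite /= Y0 // mxE coef0.
Qed.

Lemma DiffSolve0E g G f o :
  @DiffSolve A av g G f 0 o <->
  (let! B := finvmx av (\matrix_(i, j) (f i j)`_0) in
   ret (0, map_mx polyC B)) o.
Proof. by split=> [H|]; [inversion H | apply: DiffSolve0]. Qed.

Lemma DiffSolveSE g G f n o : (0 < n)%N ->
  @DiffSolve A av g G f n o <->
  (let! (Xm, Hm) := DiffSolve av G f n./2 in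
   let Hn := map_mx (take_poly n./2.+1) (Hm *+ 2 - Hm *m Hmx f Xm *m Hm) in
   let! E := fintegral av n (G - Hmx f Xm *m map_mx (@deriv A) Xm) in
   ret (map_mx (take_poly n.+1) (Xm + Hn *m E), Hn)) o.
Proof.
move=> n0; have <- : uphalf n.-1 = n./2 by rewrite -[in RHS](prednK n0).
split=> [H|]; last exact: DiffSolveS.
by inversion H as [|? ? ? ?]; subst.
Qed.

(** The second component only inverts H_f(x) to half the precision: it is
    computed from the approximation that precedes x, which agrees with x
    modulo t^(m/2 + 1). *)
Definition DiffSolve_inv g (G : 'cV[{poly A}]_g) (f : 'M[{poly A}]_g) m
    (XH : 'cV[{poly A}]_g * 'M[{poly A}]_g) :=
  [/\ forall j, (XH.1 j 0)`_0 = 0,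
      eqmodX m (Hmx f XH.1 *m map_mx (@deriv A) XH.1) G,
      eqmodX m./2.+1 (XH.2 *m Hmx f XH.1) 1%:M
    & eqmodX m./2.+1 (Hmx f XH.1 *m XH.2) 1%:M].

(** Everything that depends on the valuation is isolated in the two hypotheses:
    the initial inversion succeeds, and the coefficients of the residual of an
    approximate solution can be divided by the integers of the integration. *)
Lemma sound_DiffSolve g (G : 'cV[{poly A}]_g) (f : 'M[{poly A}]_g) n :
    sound (finvmx av (\matrix_(i, j) (f i j)`_0))
      (fun C => C *m (\matrix_(i, j) (f i j)`_0) = 1%:M) ->
    (forall m (x : 'cV[{poly A}]_g), (0 < m <= n)%N -> (forall j, (x j 0)`_0 = 0) ->
       eqmodX m./2 (Hmx f x *m map_mx (@deriv A) x) G ->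
       forall i d, (d < m)%N ->
         let r := ((G - Hmx f x *m map_mx (@deriv A) x) i 0)`_d in
         (av d.+1%:R <= av r)%E /\ exists z, r = d.+1%:R * z) ->
  forall m, (m <= n)%N -> sound (DiffSolve av G f m) (DiffSolve_inv G f m).
Proof.
move=> inv0 dvd; elim/ltn_ind=> m IHm le_mn.
have [m0|m_gt0] := posnP m.
  rewrite m0; apply: (sound_iff (fun o => iff_sym (DiffSolve0E G f o))).
  apply: sound_bind inv0 _ => C CF; apply: sound_ret.
  have H0 : eqmodX 1 (Hmx f 0) (map_mx polyC (\matrix_(i, j) (f i j)`_0)).
    apply/eqmodXP=> i j [|//] _; rewrite !mxE comp_poly0r.
    by rewrite !coefC.
  have C1 : map_mx polyC (1%:M : 'M[A]_g) = 1%:M by rewrite map_mx1.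
  split=> /=.
  - by move=> j; rewrite mxE coef0.
  - by apply/eqmodXP.
  - apply: eqmodX_trans (eqmodXM (eqmodX_refl _ _) H0) _.
    by rewrite -map_mxM CF C1; apply: eqmodX_refl.
  - apply: eqmodX_trans (eqmodXM H0 (eqmodX_refl _ _)) _.
    by rewrite -map_mxM (mulmx1C CF) C1; apply: eqmodX_refl.
apply: (sound_iff (fun o => iff_sym (DiffSolveSE G f o m_gt0))).
have lt_m2 : (m./2 < m)%N by lia.
apply: sound_bind (IHm _ lt_m2 (leq_trans (ltnW lt_m2) le_mn)) _.
move=> [x H] [/= x0 xG Hl Hr].
have dblE : (m./2.+1 <= (m./2)./2.+1.*2)%N by lia.
have {}Hl := newton_inversel dblE Hl; have {}Hr := newton_inverser dblE Hr.
set Hn := map_mx _ _ in Hl Hr *.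
apply: sound_bind.
  by apply: sound_fintegral => i d lt_dm; apply: (dvd m x _ x0 xG) => //; rewrite m_gt0.
move=> E [E0 dE lowE]; apply: sound_ret.
set y := map_mx _ _.
have Ey : eqmodX m.+1 y (x + Hn *m E) by apply: eqmodX_take.
have res0 : eqmodX m./2 (G - Hmx f x *m map_mx (@deriv A) x) 0.
  rewrite -(subrr G); apply: eqmodXD; first exact: eqmodX_refl.
  exact: eqmodXN.
have lt_m : (m./2 <= m <= m./2.*2.+1)%N by lia.
have {}lowE := lowE _ (ltnW lt_m2) res0.
have [Eyx yG] := newton_solution lt_m Hr lowE dE Ey.
have HE := eqmodX_Hmx f Eyx; split=> //=.
- by move=> j; rewrite ((eqmodXP _ _ _).1 Eyx).
- exact: eqmodX_trans (eqmodXM (eqmodX_refl _ _) HE) Hl.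
- exact: eqmodX_trans (eqmodXM HE (eqmodX_refl _ _)) Hr.
Qed.

End FixedPointIntegration.

(** * Truncation of power series *)

Section PowerSeriesTruncation.
Variable R : comNzRingType.
Implicit Types (a b x : nat -> R) (p q : {poly R}).

Lemma fps_mulE a b p q k : (forall i, (i <= k)%N -> p`_i = a i) ->
  (forall i, (i <= k)%N -> q`_i = b i) -> fps_mul a b k = (p * q)`_k.
Proof.
move=> pa qb; rewrite coefM; apply: eq_bigr => i _.
by rewrite pa ?qb // ?leq_subr // -ltnS.
Qed.

Lemma fps_expE x p d k : (forall i, (i <= k)%N -> p`_i = x i) ->
  fps_exp x d k = (p ^+ d)`_k.
Proof.
elim: d k => [|d IHd] k px; first by rewrite expr0 coef1.
rewrite exprS; apply: fps_mulE => // i le_ik; rewrite -IHd // => c le_ci.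
by apply: px; apply: leq_trans le_ik.
Qed.

Lemma coef_exp_lt p d k : p`_0 = 0 -> (k < d)%N -> (p ^+ d)`_k = 0.
Proof.
elim: d k => // d IHd k p0 lt_kd; rewrite exprS coefM big1 // => i _.
have [->|i0] := posnP i; first by rewrite p0 mul0r.
by rewrite IHd ?mulr0 //; have := ltn_ord i; lia.
Qed.

Lemma fps_compE f x p n k : p`_0 = 0 -> (k < n)%N ->
    (forall i, (i <= k)%N -> p`_i = x i) ->
  fps_comp f x k = ((\poly_(d < n) f d) \Po p)`_k.
Proof.
move=> p0 lt_kn px; rewrite coef_comp_poly /fps_comp.
rewrite (big_ord_widen n (fun d => f d * fps_exp x d k)) // big_mkcond /=.
rewrite (big_ord_widen n (fun d => (\poly_(d < n) f d)`_d * (p ^+ d)`_k)) ?size_poly //.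
rewrite [RHS]big_mkcond /=; apply: eq_bigr => d _.
rewrite coef_poly ltn_ord (fps_expE _ px).
case: ltnP => [_|lt_kd]; case: ltnP => // le_fd.
  by move/(nth_default 0): le_fd; rewrite coef_poly ltn_ord => ->; rewrite mul0r.
by rewrite coef_exp_lt ?mulr0.
Qed.

Lemma is_solution_poly g (f : 'I_g -> 'I_g -> nat -> R) G X n i k :
    is_solution f G X -> (k < n)%N ->
  ((Hmx (\matrix_(i, j) \poly_(d < n) f i j d) (\col_j \poly_(d < n.+1) X j d)
    *m map_mx (@deriv R) (\col_j \poly_(d < n.+1) X j d)) i 0)`_k = G i k.
Proof.
move=> [X0 XG] lt_kn; rewrite -XG mxE coef_sum; apply: eq_bigr => j _.
rewrite !mxE; symmetry; apply: fps_mulE => c le_ck.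
  rewrite -(@fps_compE _ (X j)) ?(leq_ltn_trans le_ck) ?coef_poly ?X0 // => d le_dc.
  by rewrite coef_poly ifT //; lia.
by rewrite coef_deriv coef_poly ifT //; lia.
Qed.

End PowerSeriesTruncation.
(** * Precision of the approximate solutions *)

Section NewtonPrecision.
Variables (K : fieldType) (v : valuation K) (p : nat).
Hypothesis hp : prime p.
Hypothesis v_nat : forall k, (0 < k)%N -> v k%:R = (logn p k)%:R%:E.
Variables (pi : uniformizer v) (e : nat).
Hypothesis he : is_ramification_index p pi e.
Variables (n k g : nat).
Hypothesis k_gt0 : (0 < k)%N.
Let M : rat := k%:R / e%:R.
Hypothesis leM : (trunc_log p n)%:R <= M.
Local Notation OK := (ringOfIntegers v).
Local Notation A := (fixp pi k).
Local Notation av := (@fixp_val K v pi k).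
Variables (f : 'M[{poly OK}]_g) (G X : 'cV[{poly OK}]_g) (B : 'M[OK]_g).
Hypothesis Bf : B *m (\matrix_(i, j) (f i j)`_0) = 1%:M.
Hypothesis X0 : forall j, (X j 0)`_0 = 0.
Hypothesis XG : eqmodX n (Hmx f X *m map_mx (@deriv OK) X) G.

Let iota : {rmorphism OK -> K} := val.
Let phi : {rmorphism OK -> A} := \pi_A.
Let v_p : v p%:R = 1%:E.
Proof. by rewrite v_nat ?prime_gt0 // logn_prime // eqxx. Qed.

Let liftK a b (C : 'M[{poly OK}]_(a, b)) := map_mx (map_poly iota) C.
Let liftA a b (C : 'M[{poly OK}]_(a, b)) := map_mx (map_poly phi) C.

Let liftK_int a b (C : 'M[{poly OK}]_(a, b)) i j :
  liftK C i j \is a polyOver (integral_pred v).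
Proof. by apply/polyOverP=> d; rewrite mxE coef_map; apply: vge_val. Qed.

Let defectE (x : 'cV[{poly OK}]_g) i :
  (Hmx (liftK f) (liftK X) *m map_mx (@deriv K) (liftK X)
    - Hmx (liftK f) (liftK x) *m map_mx (@deriv K) (liftK x)) i 0 =
  map_poly iota ((Hmx f X *m map_mx (@deriv OK) X
    - Hmx f x *m map_mx (@deriv OK) x) i 0).
Proof. by rewrite -!map_diff_op -map_mxB mxE. Qed.

Let residualE (x : 'cV[{poly OK}]_g) i d : (d < n)%N ->
  ((liftA G - Hmx (liftA f) (liftA x) *m map_mx (@deriv A) (liftA x)) i 0)`_d =
  phi ((Hmx f X *m map_mx (@deriv OK) X
    - Hmx f x *m map_mx (@deriv OK) x) i 0)`_d.
Proof.
move=> lt_dn; rewrite -map_diff_op -map_mxB mxE coef_map; congr (phi _).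
have subE (U V : 'cV[{poly OK}]_g) : (U - V) i 0 = U i 0 - V i 0 by rewrite !mxE.
by rewrite !subE !coefB ((eqmodXP _ _ _).1 XG).
Qed.

(** The zero class is lifted to 0, and not to its chosen representative, to keep
    the constant terms equal to zero. *)
Lemma lift_fixp (x : 'cV[{poly A}]_g) : (forall j, (x j 0)`_0 = 0) ->
  exists2 y, liftA y = x & forall j, (y j 0)`_0 = 0.
Proof.
move=> x0; pose l (a : A) : OK := if a == 0 then 0 else repr a.
have l0 : l 0 = 0 by rewrite /l eqxx.
exists (map_mx (map_poly l) x) => [|j]; last first.
  by rewrite mxE coef_map_id0 // x0.
apply/matrixP=> i j; rewrite !mxE; apply/polyP=> d.
rewrite coef_map coef_map_id0 // /l; case: eqP => [->|_]; first exact: rmorph0.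
exact: reprK.
Qed.

Lemma approximate_solution_precision m (x : 'cV[{poly OK}]_g) : (m <= n)%N ->
    (forall j, (x j 0)`_0 = 0) ->
    eqmodX m (Hmx (liftA f) (liftA x) *m map_mx (@deriv A) (liftA x)) (liftA G) ->
  forall j c, (c <= m)%N ->
    vge v (M - (trunc_log p c)%:R) ((liftK X - liftK x) j 0)`_c.
Proof.
move=> le_mn x0 xG.
have B_int i j : vge v 0 (map_mx iota B i j) by rewrite mxE; apply: vge_val.
have BfK : map_mx iota B *m (\matrix_(i, j) (liftK f i j)`_0) = 1%:M.
  have -> : \matrix_(i, j) (liftK f i j)`_0 = map_mx iota (\matrix_(i, j) (f i j)`_0).
    by apply/matrixP=> i j; rewrite !mxE coef_map.
  by rewrite -map_mxM Bf map_mx1.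
have lift0 (y : 'cV[{poly OK}]_g) : (forall j, (y j 0)`_0 = 0) ->
    forall j, (liftK y j 0)`_0 = 0.
  by move=> y0 j; rewrite mxE coef_map y0; apply: (rmorph0 iota).
apply: (precision_loss hp v_nat (B := map_mx iota B) (f := liftK f)) => //.
- exact: lift0.
- exact: lift0.
- by apply: le_trans leM; rewrite ler_nat leq_trunc_log.
move=> i d lt_dm; rewrite defectE coef_map.
apply/(pi_fixp_eq0 v_p he k_gt0); rewrite -[LHS]residualE; last exact: leq_trans le_mn.
have subE (U V : 'cV[{poly A}]_g) : (U - V) i 0 = U i 0 - V i 0 by rewrite !mxE.
by rewrite subE coefB ((eqmodXP _ _ _).1 xG) // subrr.
Qed.

Lemma residual_divisible m (x : 'cV[{poly A}]_g) : (0 < m <= n)%N ->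
    (forall j, (x j 0)`_0 = 0) ->
    eqmodX m./2 (Hmx (liftA f) x *m map_mx (@deriv A) x) (liftA G) ->
  forall i d, (d < m)%N ->
    let r := ((liftA G - Hmx (liftA f) x *m map_mx (@deriv A) x) i 0)`_d in
    (av d.+1%:R <= av r)%E /\ exists z, r = d.+1%:R * z.
Proof.
move=> /andP[m0 le_mn] /lift_fixp[y <- y0] yG i d lt_dm r.
have le_m2n : (m./2 <= n)%N by lia.
have prec := approximate_solution_precision le_m2n y0 yG.
rewrite /r residualE; last exact: leq_trans le_mn.
apply: (fixp_dvd_nat v_p he k_gt0); first exact: natr_neq0 v_nat _.
rewrite -[int_val _]/(iota _) -coef_map -defectE.
apply: (defect_integrable hp v_nat (f := liftK f) (M := M) _ _ _ _ _ (m := m./2) (n := m)) => //.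
- by move=> j; rewrite mxE coef_map y0; apply: (rmorph0 iota).
- by move=> j; rewrite mxE coef_map X0; apply: (rmorph0 iota).
- by lia.
by apply: le_trans leM; rewrite ler_nat leq_trunc_log.
Qed.

Lemma sound_DiffSolve_fixp :
  sound (DiffSolve av (liftA G) (liftA f) n) (fun XH =>
    forall i d, (d <= n)%N -> forall x : OK, \pi_A x = (XH.1 i 0)`_d ->
      vge v (M - (trunc_log p n)%:R) (int_val x - int_val (X i 0)`_d)).
Proof.
apply: sound_weaken.
  apply: (sound_DiffSolve (n := n)) (leqnn n).
    have BfA : map_mx phi B *m (\matrix_(i, j) (liftA f i j)`_0) = 1%:M.
      have -> : \matrix_(i, j) (liftA f i j)`_0 = map_mx phi (\matrix_(i, j) (f i j)`_0).
        by apply/matrixP=> i j; rewrite !mxE coef_map.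
      by rewrite -map_mxM Bf map_mx1.
    apply: (sound_finvmx _ _ _ _ _ _ BfA).
    - exact: (fixp_val_ge0 v_p he k_gt0).
    - exact: (fixp_val1 v_p he k_gt0).
    - exact: fixp_val0.
    - exact: (fixp_val_unit v_p he k_gt0).
    - exact: (fixp_val_addr v_p he k_gt0).
    - exact: (fixp_val_mull v_p he k_gt0).
  exact: residual_divisible.
move=> [x H] [/= /lift_fixp[y <- y0] yG _ _] i d le_dn z zE.
have /= := approximate_solution_precision (leqnn n) y0 yG i le_dn.
have -> : ((liftK X - liftK y) i 0)`_d = int_val (X i 0)`_d - int_val (y i 0)`_d.
  by rewrite !mxE coefB !coef_map.
move=> Xy.
have zy : vge v M (int_val z - int_val (y i 0)`_d).
  rewrite -int_valB; apply/(pi_fixp_eq0 v_p he k_gt0).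
  by rewrite pi_fixpB zE mxE coef_map subrr.
have -> : int_val z - int_val (X i 0)`_d =
    (int_val z - int_val (y i 0)`_d) - (int_val (X i 0)`_d - int_val (y i 0)`_d).
  by ring.
apply: vgeD; first by apply: vgeW zy; rewrite lerBlDr lerDl ler0n.
by apply: vgeN; apply: vgeW Xy; rewrite lerB // ler_nat leq_trunc_log.
Qed.

End NewtonPrecision.

Lemma is_padic_field_natr p (Qp : fieldType) (vp : valuation Qp) m : prime p ->
  is_padic_field p vp -> (0 < m)%N -> vp m%:R = (logn p m)%:R%:E.
Proof.
move=> hp hQp m0; rewrite -(ratr_nat Qp m) (padic_ext hQp) ?pnatr_eq0 -?lt0n //.
by rewrite /padic_val -[m%:R]/(m%:Q) numq_int denq_int /= logn1 subr0.
Qed.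

Theorem theorem15
  (p : nat) (hp : prime p)
  (Qp : fieldType) (vp : valuation Qp) (hQp : is_padic_field p vp)
  (K : fieldExtType Qp) (v : valuation K)
  (hv : forall x : Qp, v (x%:A) = vp x)
  (pi : uniformizer v)
  (e : nat) (he : is_ramification_index p pi e)
  (n g : nat) (hn : (1 <= n)%N) (hg : (1 <= g)%N)
  (N : rat) (hN0 : 0 < N)
  (eN : nat) (heN : e%:R * N = eN%:R)
  (eM : nat) (heM : e%:R * working_precision p n N = eM%:R)
  (G : 'I_g -> nat -> ringOfIntegers v)
  (f : 'I_g -> 'I_g -> nat -> ringOfIntegers v)
  (hf0 : exists B : 'M[ringOfIntegers v]_g,
     (\matrix_(i, j) f i j 0%N) *m B = 1%:M /\
     B *m (\matrix_(i, j) f i j 0%N) = 1%:M)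
  (X : 'I_g -> nat -> K)
  (hX : is_solution (fun i j d => int_val (f i j d)) (fun i d => int_val (G i d)) X)
  (hXint : forall j d, (0 <= v (X j d))%E) :
  let run := DiffSolve (@fixp_val K v pi eM)
               (red_col pi eM n G) (red_mx pi eM n f) n in
  [/\ ~ run None,
      exists XH, run (Some XH)
    & forall Xn Hn, run (Some (Xn, Hn)) ->
        forall (i : 'I_g) (d : nat), (d <= n)%N ->
        forall x : ringOfIntegers v,
          \pi_(fixp pi eM) x = (Xn i 0)`_d ->
        exists z : ringOfIntegers v,
          int_val x - X i d = int_val ((pi : ringOfIntegers v) ^+ eN * z)].
Proof.
have v_nat m : (0 < m)%N -> v m%:R = (logn p m)%:R%:E.
  move=> m0; rewrite -(is_padic_field_natr hp hQp m0) -hv.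
  by rewrite scaler_nat.
have v_p : v p%:R = 1%:E by rewrite v_nat ?prime_gt0 // logn_prime // eqxx.
have e0 := ramif_gt0 v_p he.
have leNM : N + (trunc_log p n)%:R <= working_precision p n N.
  rewrite /working_precision lerD2r.
  by case: ifP => _; [|case: ifP => _]; rewrite ?le_max lexx.
have ME : eM%:R / e%:R = working_precision p n N by rewrite -heM mulrC mulKf ?lt0r_neq0.
have NE : eN%:R / e%:R = N by rewrite -heN mulrC mulKf ?lt0r_neq0.
have leM : (trunc_log p n)%:R <= eM%:R / e%:R :> rat.
  by rewrite ME; apply: le_trans leNM; rewrite lerDr ltW.
have eM0 : (0 < eM)%N.
  rewrite -(ltr0n rat) -heM mulr_gt0 //; apply: lt_le_trans leNM.
  by rewrite ltr_wpDr ?ler0n.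
pose fO : 'M[{poly ringOfIntegers v}]_g := \matrix_(i, j) \poly_(d < n) f i j d.
pose GO : 'cV[{poly ringOfIntegers v}]_g := \col_i \poly_(d < n) G i d.
pose XO : 'cV[{poly ringOfIntegers v}]_g :=
  \col_j \poly_(d < n.+1) RingOfIntegers (hXint j d : X j d \in integral_pred v).
have [B [_ Bf]] := hf0.
have fO0 : \matrix_(i, j) (fO i j)`_0 = \matrix_(i, j) f i j 0%N.
  by apply/matrixP=> i j; rewrite !mxE coef_poly hn.
rewrite -fO0 in Bf.
have XO0 j : (XO j 0)`_0 = 0.
  by rewrite mxE coef_poly /=; apply: val_inj; case: hX => /(_ j).
have redG : red_col pi eM n G = map_mx (map_poly (\pi_(fixp pi eM))) GO.
  apply/matrixP=> i j; rewrite !mxE; apply/polyP=> d.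
  by rewrite coef_map !coef_poly; case: ifP => // _; exact/esym/(rmorph0 (\pi_(fixp pi eM))).
have redf : red_mx pi eM n f = map_mx (map_poly (\pi_(fixp pi eM))) fO.
  apply/matrixP=> i j; rewrite !mxE; apply/polyP=> d.
  by rewrite coef_map !coef_poly; case: ifP => // _; exact/esym/(rmorph0 (\pi_(fixp pi eM))).
pose iota : {rmorphism ringOfIntegers v -> K} := val.
have mapf : map_mx (map_poly iota) fO =
    \matrix_(i, j) \poly_(d < n) int_val (f i j d).
  apply/matrixP=> i j; rewrite !mxE; apply/polyP=> d.
  by rewrite coef_map !coef_poly; case: ifP => // _; apply: (rmorph0 iota).
have mapX : map_mx (map_poly iota) XO = \col_j \poly_(d < n.+1) X j d.
  apply/matrixP=> i j; rewrite !mxE; apply/polyP=> d.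
  by rewrite coef_map !coef_poly; case: ifP => // _; apply: (rmorph0 iota).
have XGO : eqmodX n (Hmx fO XO *m map_mx (@deriv _) XO) GO.
  apply/eqmodXP=> i j d lt_dn; rewrite ord1 [in RHS]mxE coef_poly lt_dn.
  have := is_solution_poly i hX lt_dn; rewrite -mapf -mapX -map_diff_op mxE.
  by rewrite coef_map => /int_val_inj.
rewrite redG redf /=.
have [runN runS runP] :=
  sound_DiffSolve_fixp hp v_nat he eM0 leM Bf XO0 XGO.
split=> // Xn Hn run i d le_dn x xE.
have := runP _ run i d le_dn x xE.
rewrite mxE coef_poly ltnS le_dn /= => prec.
have : vge v (eN%:R / e%:R) (int_val x - X i d).
  by apply: vgeW prec; rewrite NE ME lerBrDr.
have [y <-] : {y : ringOfIntegers v | int_val y = int_val x - X i d}.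
  apply: ringOfIntegersE; rewrite -[0]addr0; apply: vgeD; first exact: vge_val.
  by apply: vgeN; apply: hXint.
by move=> /(dvd_unifP v_p he)[z ->]; exists z.
Qed.
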